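(* The EKG sequence satisfies $a(n)\ge \left\lceil \frac{1}{260}\, n\right\rceil$ for all integers $n\ge 1$.
   Context: The EKG sequence $(a(n))_{n\ge 1}$ is the sequence of positive integers defined by $a(1)=1$, $a(2)=2$ and, for $n\ge 3$, $a(n)$ is the smallest positive integer not in $\{a(k): 1\le k\le n-1\}$ such that $\gcd(a(n-1),a(n))\ge 2$. *)

(* Defs.v *)
From mathcomp Require Import all_boot all_order all_algebra.

Set Implicit Arguments.
Unset Strict Implicit.
Unset Printing Implicit Defensive.

Definition EKG_candidate (a : nat -> nat) (n m : nat) : Prop :=
  [/\ 0 < m, forall k, 1 <= k <= n - 1 -> a k <> m & 2 <= gcdn (a (n - 1)) m].

(* The sequence is indexed from 1: the value [a 0] is unconstrained. *)
Definition is_EKG (a : nat -> nat) : Prop :=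
  [/\ a 1 = 1, a 2 = 2 &
      forall n, 3 <= n ->
        EKG_candidate a n (a n) /\
        (forall m, EKG_candidate a n m -> a n <= m)].

Lemma EKG_next_ex (s : seq nat) : 1 < head 0 s ->
  exists m, [&& 0 < m, m \notin s & 1 < gcdn (head 0 s) m].
Proof.
move=> s1; have s0 : 0 < head 0 s by exact: ltnW.
exists (head 0 s * (sumn s).+1); rewrite muln_gt0 s0 gcdnMr s1 /= andbT.
apply/negP => ms; have : head 0 s * (sumn s).+1 <= sumn s.
  by rewrite [leqRHS](perm_sumn (perm_to_rem ms)); apply: leq_addr.
by rewrite leqNgt (leq_trans _ (leq_pmull _ s0)).
Qed.

Lemma EKG_next_gt1 (s : seq nat) (s1 : 1 < head 0 s) :
  1 \in s -> 1 < ex_minn (EKG_next_ex s1).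
Proof.
move=> ms; case: ex_minnP => m /and3P[m0 mNs _] _.
by rewrite ltn_neqAle m0 andbT; apply: contraNneq mNs => <-.
Qed.

Definition EKG_state := {s : seq nat | (1 < head 0 s) && (1 \in s)}.

Definition EKG_next (s : EKG_state) : nat :=
  ex_minn (EKG_next_ex (proj1 (andP (valP s)))).

Lemma EKG_step_subproof (s : EKG_state) :
  (1 < head 0 (EKG_next s :: val s)) && (1 \in EKG_next s :: val s).
Proof.
have [_ s1] := andP (valP s).
by apply/andP; split; [apply: EKG_next_gt1 | rewrite inE s1 orbT].
Qed.

Definition EKG_step (s : EKG_state) : EKG_state :=
  exist _ (EKG_next s :: val s) (EKG_step_subproof s).

Definition EKG_init : EKG_state := exist _ [:: 2; 1] isT.

Lemma EKG_exists : exists a, is_EKG a.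
Proof.
pose st n := iter n EKG_step EKG_init.
pose a n := if n is k.+2 then head 0 (val (st k)) else 1.
have stE n k : (k \in val (st n)) <-> exists2 i, 1 <= i <= n.+2 & a i = k.
  elim: n => [|n IHn].
    rewrite !inE; split=> [/orP[]/eqP->|[i]]; first by exists 2.
      by exists 1.
    by case: i => [|[|[|i]]] //= _ <-.
  rewrite inE; split=> [/orP[/eqP->|/IHn[i /andP[i0 il] <-]]|[i]].
  - by exists n.+3; rewrite ?leqnn.
  - by exists i; rewrite // i0 ltnW.
  - rewrite (leq_eqVlt i) => /andP[i0 /orP[/eqP-> <-|il ai]].
      by rewrite eqxx.
    by apply/orP; right; apply/IHn; exists i; rewrite // i0.
exists a; split=> // -[|[|[|n]]] // _.
have candE m : EKG_candidate a n.+3 m <->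
    [&& 0 < m, m \notin val (st n) & 1 < gcdn (head 0 (val (st n))) m].
  rewrite /EKG_candidate subn1 /=; split=> [[m0 nm g]|/and3P[m0 nm g]].
    by rewrite m0 g andbT; apply/negP => /stE[i /nm].
  by split=> // k kn akm; case/negP: nm; apply/stE; exists k.
rewrite [a n.+3]/= /EKG_next; case: ex_minnP => m /candE mc mmin.
by split=> // p /candE; apply: mmin.
Qed.

Lemma EKG_unique (a b : nat -> nat) : is_EKG a -> is_EKG b ->
  forall n, 1 <= n -> a n = b n.
Proof.
move=> [a1 a2 aS] [b1 b2 bS].
elim/ltn_ind => -[|[|[|n]]] // IHn _; rewrite ?a1 ?a2 //.
have E k : 1 <= k <= n.+2 -> a k = b k by case/andP=> k0 kn; apply: IHn.
have candE m : EKG_candidate a n.+3 m <-> EKG_candidate b n.+3 m.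
  rewrite /EKG_candidate subn1 /= E ?leqnn //.
  by split=> -[m0 nm g]; split=> // k kn; [rewrite -E|rewrite E] => //; apply: nm.
have [/candE ac amin] := aS n.+3 isT; have [/candE bc bmin] := bS n.+3 isT.
by apply/eqP; rewrite eqn_leq amin ?bmin.
Qed.

(* Main.v *)
(* Let B(t, s) be the least multiple of s missing from a(1), ..., a(t), and B = B(t, 2).
   A term sharing a factor s with its predecessor a(t) equals B(t, s), and a term following a
   multiple of s is at most B(t, s). Hence the even terms among the first t are followed by
   distinct numbers below B, so fewer than B even numbers have appeared.

   Upper bound: a(t+1) <= 10 B. Suppose a(t+1) = p w is larger, p an odd prime. All p j with
   j <= w have appeared. Those exceeding B followed an odd term; either some odd prime s <> p
   divides j and every multiple of s up to p j has appeared, or the predecessor is p i where, up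
   to one exception, i is odd and of the former kind. So many j <= w have a factor s as above,
   and a second moment (Cauchy-Schwarz) estimate turns this into at least B even terms, which is
   a contradiction. As the terms are distinct, t < 6 B.

   Lower bound: let m be missing and suppose 3 B > 130 m. For q a prime factor of m, all
   2 q j < B have appeared, each followed by a number below m. The same second moment estimate
   limits how many of them can have appeared when all even numbers below 5 m first have. Each of
   the others is followed by an odd number below m, which is a multiple of q or of some other
   prime s dividing j with B(., s) <= m; this makes the sum of 1/s over such s at least 1/3.
   Even multiples of such s, multiples of 2 q, and even numbers below m are all followed by
   distinct numbers below m, but by Bonferroni's inequality there are more than m of them.
   Hence 3 B <= 130 m and t < 6 B <= 260 m. *)
Require Import Defs.
From mathcomp Require Import all_boot all_order all_algebra.
From mathcomp Require Import zify ring lra.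

Set Implicit Arguments.
Unset Strict Implicit.
Unset Printing Implicit Defensive.

Import Order.TTheory GRing.Theory Num.Theory.

(** * Second moment and Bonferroni estimates *)

Section Sieves.
Local Open Scope ring_scope.

(** Expand the sum of the squares of [#|A| * f i - S], which is nonnegative. *)
Lemma sqr_sum_le (I : finType) (A : {set I}) (f : I -> rat) :
  (\sum_(i in A) f i) ^+ 2 <= #|A|%:R * \sum_(i in A) f i ^+ 2.
Proof.
set S := \sum_(i in A) f i; set Q := \sum_(i in A) f i ^+ 2.
have [A0|Agt0] := posnP #|A|.
  by rewrite A0 mul0r /S (cards0_eq A0) big_set0 expr0n.
have n0 : (0 : rat) < #|A|%:R by rewrite ltr0n.
have E : \sum_(i in A) (#|A|%:R * f i - S) ^+ 2 =
    #|A|%:R * (#|A|%:R * Q - S ^+ 2).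
  transitivity (\sum_(i in A)
      (#|A|%:R ^+ 2 * f i ^+ 2 - (2 * #|A|%:R * S) * f i + S ^+ 2)).
    by apply: eq_bigr => i _; ring.
  by rewrite big_split /= sumrB -!mulr_sumr -/S -/Q sumr_const -mulr_natl; ring.
have : 0 <= #|A|%:R * (#|A|%:R * Q - S ^+ 2).
  by rewrite -E; apply: sumr_ge0 => i _; apply: sqr_ge0.
by rewrite pmulr_rge0 // subr_ge0.
Qed.

(** [N] is only an ambient bound, kept above [D] whenever elements are counted. *)
Definition multiples N d D : {set 'I_N} :=
  [set i : 'I_N | [&& (0 < i)%N, (d %| i)%N & (i <= D)%N]].

Lemma card_multiples N d D : (0 < d)%N -> (D < N)%N ->
  #|multiples N d D| = (D %/ d)%N.
Proof.
move=> d0 DN.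
have lt_N (k : 'I_(D %/ d)) : (d * k.+1 < N)%N.
  by apply: leq_ltn_trans DN; rewrite mulnC -leq_divRL.
pose g k := Ordinal (lt_N k).
have g_inj : injective g.
  by move=> x y /(congr1 val) /= /eqP; rewrite eqn_pmul2l // => /eqP[] /val_inj.
rewrite -[RHS]card_ord -(card_imset _ g_inj); congr #|pred_of_set _|.
apply/setP => i; rewrite inE; apply/idP/imsetP => [/and3P[i0 /dvdnP[c ci] iD]|[k _ ->]].
  have c0 : (0 < c)%N by move: i0; rewrite ci muln_gt0 => /andP[].
  have cD : (c.-1 < D %/ d)%N by rewrite prednK // leq_divRL // -ci.
  by exists (Ordinal cD) => //; apply: val_inj; rewrite /= prednK // mulnC.
by rewrite /= muln_gt0 d0 dvdn_mulr //= mulnC -leq_divRL.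
Qed.

Lemma sum_indicator (I : finType) (A B : {set I}) : B \subset A ->
  \sum_(i in A) ((i \in B)%:R : rat) = #|B|%:R.
Proof.
move=> BA; rewrite -natr_sum; congr _%:R.
rewrite -sum1_card [RHS]big_mkcond [LHS]big_mkcond; apply: eq_bigr => i _.
by case: ifPn => [_|]; [case: (i \in B)|move/(contra (subsetP BA i))/negPf->].
Qed.

(* Cauchy-Schwarz for the function [i |-> \sum_a w a / #|X (c a)| * (i \in X (c a))]. *)
Lemma weighted_overlap (N r : nat) (J c : nat -> nat) (X : nat -> {set 'I_N})
    (A : {set 'I_N}) (l : rat) (w : nat -> rat) :
  0 < l -> (forall a, (a < r)%N -> 0 <= w a) ->
  (forall a, (a < r)%N -> (0 < J a)%N) ->
  (forall a, (a < r)%N -> X (c a) \subset A) ->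
  (forall a, (a < r)%N ->
     l * #|[set b : 'I_r | c b == c a]|%:R <= #|X (c a)|%:R) ->
  (forall a b, (a < r)%N -> (b < r)%N -> c a != c b ->
     l * #|X (c a) :&: X (c b)|%:R * (J b)%:R <= #|X (c a)|%:R * #|X (c b)|%:R) ->
  l * (\sum_(a < r) w a) ^+ 2 <= #|A|%:R *
    (\sum_(a < r) w a ^+ 2 + \sum_(a < r) \sum_(b < r) w a * w b / (maxn (J a) (J b))%:R).
Proof.
move=> l0 w0 J0 XA cX XX.
pose x a : rat := #|X (c a)|%:R.
have n0 (a : 'I_r) : 0 < #|[set b : 'I_r | c b == c a]|%:R :> rat.
  by rewrite ltr0n card_gt0; apply/set0Pn; exists a; rewrite inE.
have x0 (a : 'I_r) : 0 < x a.
  by apply: lt_le_trans (cX a (ltn_ord a)); rewrite mulr_gt0.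
pose d (i : 'I_N) := \sum_(a < r) w a / x a * (i \in X (c a))%:R.
have sum_d : \sum_(i in A) d i = \sum_(a < r) w a.
  rewrite exchange_big /=; apply: eq_bigr => a _.
  by rewrite -mulr_sumr sum_indicator ?XA // divfK // gt_eqF // x0.
pose y a b : rat := #|X (c a) :&: X (c b)|%:R.
have sum_d2 : \sum_(i in A) d i ^+ 2 =
    \sum_(a < r) \sum_(b < r) (w a / x a) * (w b / x b) * y a b.
  under eq_bigr => i _ do rewrite expr2 big_distrlr /=.
  rewrite exchange_big /=; apply: eq_bigr => a _.
  rewrite exchange_big /=; apply: eq_bigr => b _.
  rewrite /y -(@sum_indicator _ A); last first.
    by apply: subset_trans (XA a (ltn_ord a)); apply: subsetIl.
  rewrite mulr_sumr; apply: eq_bigr => i _.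
  by rewrite inE -mulnb natrM; ring.
pose m a b : rat := (maxn (J a) (J b))%:R.
have m0 (a b : 'I_r) : 0 < m a b by rewrite ltr0n leq_max J0.
pose g a b : rat := (c b == c a)%:R.
(* For equal labels use [(w a - w b)^2 >= 0]. For different labels the overlap hypothesis is applied
   with the larger of [J a] and [J b] in the role of [J b], by symmetry of the intersection. *)
have term (a b : 'I_r) : l * ((w a / x a) * (w b / x b) * y a b) <=
    l * g a b * (w a ^+ 2 / x a / 2 + w b ^+ 2 / x b / 2) + w a * w b / m a b.
  have wa := w0 a (ltn_ord a); have wb := w0 b (ltn_ord b).
  have xa := x0 a; have xb := x0 b.
  rewrite /g; case: eqVneq => [E|NE].
    have -> : y a b = x a by rewrite /y /x E setIid.
    have -> : x b = x a by rewrite /x E.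
    apply: ler_wpDr; first by rewrite divr_ge0 ?mulr_ge0 // ltW.
    rewrite mulr1 ler_pM2l // -subr_ge0.
    have -> : w a ^+ 2 / x a / 2 + w b ^+ 2 / x a / 2 - w a / x a * (w b / x a) * x a =
              (w a - w b) ^+ 2 / x a / 2 by field; rewrite gt_eqF.
    by rewrite !divr_ge0 ?sqr_ge0 // ltW.
  rewrite mulr0 mul0r add0r.
  have H : l * y a b * m a b <= x a * x b.
    rewrite /m; case: (leqP (J a) (J b)) => [_|_].
      by apply: XX; rewrite // eq_sym.
    by rewrite /y setIC [leRHS]mulrC; apply: XX.
  have -> : l * (w a / x a * (w b / x b) * y a b) =
     (w a * w b / m a b) * ((l * y a b * m a b) / (x a * x b)).
    by field; apply/and3P; split; apply: lt0r_neq0; [exact: x0|exact: x0|exact: m0].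
  apply: ler_piMr; first by rewrite divr_ge0 ?mulr_ge0 // ltW ?m0.
  by rewrite ler_pdivrMr ?mulr_gt0 // mul1r.
rewrite -sum_d; apply: le_trans (_ : l * (#|A|%:R * \sum_(i in A) d i ^+ 2) <= _).
  by rewrite ler_pM2l // sqr_sum_le.
rewrite mulrCA ler_wpM2l // sum_d2 mulr_sumr.
apply: le_trans (_ : \sum_(a < r) \sum_(b < r)
    (l * g a b * (w a ^+ 2 / x a / 2 + w b ^+ 2 / x b / 2) + w a * w b / m a b) <= _).
  by apply: ler_sum => a _; rewrite mulr_sumr; apply: ler_sum => b _; apply: term.
under eq_bigr => a _ do rewrite big_split /=.
rewrite big_split /= lerD2r.
(* The class of [a] has at most [x a / l] members, which cancels [l / x a]; the other half of the
   equal-label terms is the same sum with [a] and [b] exchanged. *)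
have half (a : 'I_r) : \sum_(b < r) l * g a b * (w a ^+ 2 / x a / 2) <= w a ^+ 2 / 2.
  rewrite -mulr_suml -mulr_sumr -natr_sum.
  have -> : (\sum_(b < r) (c b == c a) = #|[set b : 'I_r | c b == c a]|)%N.
    by rewrite -sum1_card [RHS]big_mkcond; apply: eq_bigr => b _; rewrite inE; case: eqP.
  have -> : w a ^+ 2 / x a / 2 = (w a ^+ 2 / 2) / x a by field; apply: lt0r_neq0; exact: x0.
  rewrite mulrCA; apply: ler_piMr; first by rewrite divr_ge0 ?sqr_ge0.
  by rewrite ler_pdivrMr // mul1r; apply: cX.
have -> : \sum_(a < r) \sum_(b < r) l * g a b * (w a ^+ 2 / x a / 2 + w b ^+ 2 / x b / 2) =
   (\sum_(a < r) \sum_(b < r) l * g a b * (w a ^+ 2 / x a / 2)) +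
   (\sum_(a < r) \sum_(b < r) l * g a b * (w a ^+ 2 / x a / 2)).
  under eq_bigr => a _ do under eq_bigr => b _ do rewrite mulrDr.
  under eq_bigr => a _ do rewrite big_split /=.
  rewrite big_split /=; congr (_ + _); rewrite exchange_big /=.
  by apply: eq_bigr => a _; apply: eq_bigr => b _; rewrite /g eq_sym.
rewrite -big_split /=; apply: ler_sum => a _.
by rewrite [leRHS](splitr) lerD.
Qed.

(** * The second moment bound with ranks as weights *)

Lemma sum_ranks r : \sum_(a < r) (a.+1%:R : rat) = r%:R * (r%:R + 1) / 2.
Proof.
elim: r => [|r IHr]; first by rewrite big_ord0; lra.
by rewrite big_ord_recr /= IHr -!natr1; field.
Qed.

Lemma sum_sqr_ranks r : \sum_(a < r) (a.+1%:R : rat) ^+ 2 =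
  r%:R * (r%:R + 1) * (2 * r%:R + 1) / 6.
Proof.
elim: r => [|r IHr]; first by rewrite big_ord0; lra.
by rewrite big_ord_recr /= IHr -!natr1; field.
Qed.

(** Induction on [r]: in the last row and column the maximum is [J r], and the numerators add up to
    [(r + 1) * (2 * (1 + ... + r) + (r + 1)) = (r + 1)^3]. *)
Lemma sum_ranks_max (J : nat -> nat) r :
  (forall a b, (a <= b)%N -> (b < r)%N -> (J a <= J b)%N) ->
  \sum_(a < r) \sum_(b < r) (a.+1%:R * b.+1%:R / (maxn (J a) (J b))%:R : rat) =
  \sum_(a < r) a.+1%:R ^+ 3 / (J a)%:R.
Proof.
elim: r => [|r IHr] Jmono; first by rewrite !big_ord0.
rewrite !big_ord_recr /= maxnn.
under eq_bigr => a _ do rewrite big_ord_recr /= (maxn_idPr (Jmono _ _ (ltnW (ltn_ord a)) (ltnSn r))).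
rewrite big_split /= IHr; last by move=> a b ab br; apply: Jmono => //; apply: ltnW.
under [X in _ + (X + _)]eq_bigr => b _ do rewrite (maxn_idPl (Jmono _ _ (ltnW (ltn_ord b)) (ltnSn r))).
rewrite -addrA; congr (_ + _).
rewrite -!mulr_suml -mulr_sumr sum_ranks -!natr1.
by rewrite -!mulrDl; congr (_ / _); field.
Qed.

(* The weight of the [a]-th element [J a] of [R] is its rank, so that
   [w a * w b / maxn (J a) (J b) <= minn (w a) (w b)]. *)
Lemma rank_sieve (N : nat) (R : seq nat) (c f : nat -> nat) (X : nat -> {set 'I_N})
    (A : {set 'I_N}) (l : rat) :
  0 < l -> sorted ltn R ->
  (forall j, j \in R -> [&& (0 < j)%N, (0 < c j)%N, (c j %| j)%N & (j <= c j * f (c j))%N]) ->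
  (forall j, j \in R -> X (c j) \subset A) ->
  (forall j, j \in R -> l * (f (c j))%:R <= #|X (c j)|%:R) ->
  (forall i j, i \in R -> j \in R -> c i != c j ->
     l * #|X (c i) :&: X (c j)|%:R * (c j * f (c j))%:R <= #|X (c i)|%:R * #|X (c j)|%:R) ->
  3 * l * (size R)%:R * ((size R)%:R + 1) <= 4 * (2 * (size R)%:R + 1) * #|A|%:R /\
  (all odd R -> l * (size R)%:R <= 2 * #|A|%:R).
Proof.
move=> l0 sR cR XA Xf XX.
set r := size R; pose J := nth 0%N R.
have JR a : (a < r)%N -> J a \in R by apply: mem_nth.
have Jlt a b : (a < b)%N -> (b < r)%N -> (J a < J b)%N.
  move=> ab br; rewrite /J (sorted_ltn_nth ltn_trans 0%N sR) ?inE //.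
  exact: ltn_trans br.
have Jle a b : (a <= b)%N -> (b < r)%N -> (J a <= J b)%N.
  by rewrite leq_eqVlt => /predU1P[-> //|ab br]; apply/ltnW/Jlt.
have J0 a : (a < r)%N -> (0 < J a)%N by move=> /JR/cR/andP[].
(* Elements with label [s] are distinct positive multiples of [s] up to [s * f s]. *)
have classes a : (a < r)%N -> (#|[set b : 'I_r | c (J b) == c (J a)]| <= f (c (J a)))%N.
  move=> ar; have /and4P[_ s0 _ _] := cR _ (JR a ar).
  set s := c (J a); set D := (s * f s)%N.
  have D1 b : b \in [set b : 'I_r | c (J b) == s] -> (J b < D.+1)%N.
    by rewrite inE ltnS => /eqP cb; have /and4P[_ _ _] := cR _ (JR b (ltn_ord b)); rewrite cb.
  have inj : {in [set b : 'I_r | c (J b) == s] &, injective (fun b : 'I_r => inord (J b) : 'I_D.+1)}.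
    move=> b b' bs bs' /(congr1 val); rewrite /= !inordK ?D1 // => E; apply/val_inj => /=.
    by case: (ltngtP b b') => // /Jlt H; [move: (H (ltn_ord b')) | move: (H (ltn_ord b))]; rewrite E ltnn.
  rewrite -(card_in_imset inj).
  have <- : #|multiples D.+1 s D| = f s by rewrite card_multiples // mulKn.
  apply/subset_leq_card/subsetP => _ /imsetP[b bs ->].
  rewrite inE inordK ?D1 //; move: (D1 b bs); rewrite ltnS => ->.
  by move: bs; rewrite inE => /eqP <-; have /and4P[-> _ -> _] := cR _ (JR b (ltn_ord b)).
have H : l * (r%:R * (r%:R + 1) / 2) ^+ 2 <= #|A|%:R *
    (r%:R * (r%:R + 1) * (2 * r%:R + 1) / 6 + \sum_(a < r) a.+1%:R ^+ 3 / (J a)%:R).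
  rewrite -sum_ranks -sum_sqr_ranks -(sum_ranks_max Jle).
  apply: (@weighted_overlap _ _ J (fun a => c (J a)) X A l (fun a => a.+1%:R)) => //.
  - by move=> a ar; apply/XA/JR.
  - move=> a ar; apply: le_trans (Xf _ (JR a ar)).
    by rewrite ler_pM2l // ler_nat classes.
  - move=> a b ar br cab; apply: le_trans (XX _ _ (JR a ar) (JR b br) cab).
    apply: ler_wpM2l; first by rewrite mulr_ge0 // ltW.
    by rewrite ler_nat; have /and4P[] := cR _ (JR b br).
have [r0|rgt0] := posnP r.
  rewrite r0; split=> [|_]; last by rewrite mulr0 mulr_ge0.
  by rewrite mulr0 mul0r !mulr_ge0 // mulr0 add0r.
have rr : (1 : rat) <= r%:R by rewrite ler1n.
have A0 : (0 : rat) <= #|A|%:R by [].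
set S : rat := \sum_(a < r) _ in H; set n : rat := #|A|%:R in H A0 *.
split.
  (* Strict growth from a positive start gives [J a >= a + 1], so each cube over [J a] is at most a
     square. *)
  have S_le : S <= r%:R * (r%:R + 1) * (2 * r%:R + 1) / 6.
    rewrite -sum_sqr_ranks; apply: ler_sum => a _.
    rewrite exprSr ler_pdivrMr ?ltr0n ?J0 // ler_wpM2l ?sqr_ge0 // ler_nat.
    case: a => a /= ar; elim: a ar => [|a IHa] ar; first exact: J0.
    by apply: leq_ltn_trans (Jlt _ _ (ltnSn a) ar); apply: IHa; apply: ltnW.
  have rpos : 0 < r%:R * (r%:R + 1) :> rat by nra.
  rewrite -(ler_pM2r rpos).
  have : n * S <= n * (r%:R * (r%:R + 1) * (2 * r%:R + 1) / 6) by rewrite ler_wpM2l.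
  move: H; set x : rat := r%:R; move: (l) (S); clear => l S; lra.
move=> oddR.
(* Odd entries give [J a >= 2 * a + 1]. With [u = a + 1], the product
   [(u^2 / 2 + u / 4 + 1 / 4) * (2 * u - 1)] exceeds [u^3] by [(u - 1) / 4]. *)
have S_le : S <= \sum_(a < r) (a.+1%:R ^+ 2 / 2 + a.+1%:R / 4 + 1 / 4).
  apply: ler_sum => a _; rewrite ler_pdivrMr ?ltr0n ?J0 //.
  have Ja : (a.*2.+1 <= J a)%N.
    case: a => a /= ar; elim: a ar => [|a IHa] ar; first exact: J0.
    have o1 := allP oddR _ (JR _ ar); have o2 := allP oddR _ (JR _ (ltnW ar)).
    have := Jlt _ _ (ltnSn a) ar; have := IHa (ltnW ar).
    lia.
  have : ((a.*2.+1)%:R : rat) <= (J a)%:R by rewrite ler_nat.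
  rewrite -[a.+1%:R]natr1 -[_.*2.+1%:R]natr1 -mul2n natrM; have : 0 <= a%:R :> rat by [].
  move: (a%:R : rat) ((J a)%:R : rat) => x y x0 xy.
  have : 0 <= ((x + 1) ^+ 2 / 2 + (x + 1) / 4 + 1 / 4) * (y - (2 * x + 1)).
    by rewrite mulr_ge0 ?subr_ge0 // !addr_ge0 ?divr_ge0 ?sqr_ge0 // addr_ge0.
  lra.
rewrite !big_split /= -!mulr_suml sum_ranks sum_sqr_ranks sumr_const card_ord -mulr_natr in S_le.
have rpos : 0 < r%:R * (r%:R + 1) ^+ 2 :> rat by nra.
have : n * S <= n * (r%:R * (r%:R + 1) * (2 * r%:R + 1) / 6 / 2 + r%:R * (r%:R + 1) / 2 / 4 + 1 / 4 * r%:R).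
  by apply: ler_wpM2l => //; lra.
move: rpos H A0 rr; clear.
move: (r%:R : rat) (n : rat) (S : rat) => x n' S' x0 H n0 x1 H2.
rewrite -(ler_pM2r x0).
have : 0 <= n' * x * (x - 1) by rewrite !mulr_ge0 //; lra.
lra.
Qed.

(** This is the second Bonferroni inequality, doubled: the double sum contains each diagonal term
    once and each unordered pair twice. It is proved pointwise, [d i] being the number of sets that
    contain [i]. *)
Lemma bonferroni (T : Type) (I : finType) (U : {set I}) (A : T -> {set I}) (s : seq T) :
  (forall t, A t \subset U) ->
  (3 * \sum_(t <- s) #|A t| <=
   2 * #|U| + \sum_(t <- s) \sum_(t' <- s) #|A t :&: A t'|)%N.
Proof.
move=> AU; pose d i := (\sum_(t <- s) (i \in A t))%N.
have cardE (B : {set I}) : B \subset U -> #|B| = (\sum_(i in U) (i \in B))%N.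
  move=> BU; rewrite -sum1_card big_mkcond [RHS]big_mkcond; apply: eq_bigr => i _.
  by case: (boolP (i \in U)) => [_|/(contra (subsetP BU i))/negPf->] //; case: (i \in B).
under eq_bigr => t _ do rewrite (cardE _ (AU t)).
under [X in (_ <= _ + X)%N]eq_bigr => t _ do
  under eq_bigr => t' _ do rewrite (cardE _ (subset_trans (subsetIl _ _) (AU t))).
rewrite exchange_big /=.
under [X in (_ <= _ + X)%N]eq_bigr => t _ do rewrite exchange_big /=.
rewrite [X in (_ <= _ + X)%N]exchange_big /= -sum1_card !big_distrr /= -big_split /=.
apply: leq_sum => i _; rewrite -/(d i).
have -> : (\sum_(t <- s) \sum_(t' <- s) (i \in A t :&: A t') = d i * d i)%N.
  rewrite big_distrlr /=; apply: eq_bigr => t _; apply: eq_bigr => t' _.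
  by rewrite inE mulnb.
(* [(d - 1) * (d - 2) >= 0] for every natural number [d]. *)
by case: (d i) => [|[|[|n]]] //; lia.
Qed.

(** Each reciprocal is at most 1/3, so the shortest prefix reaching [x] overshoots by at most 1/3.
    Allowing [x] down to -1/3 lets the induction subtract a term from a positive target. *)
Lemma take_sum_inv (S : seq nat) (x : rat) : all (leq 3) S -> - (1 / 3) <= x ->
  x <= \sum_(s <- S) s%:R^-1 ->
  exists2 n, x <= \sum_(s <- take n S) s%:R^-1 & \sum_(s <- take n S) s%:R^-1 <= x + 1 / 3.
Proof.
elim: S x => [|s S IHS] x.
  by rewrite big_nil => _ x0 x1; exists 0%N; lra.
rewrite big_cons /= => /andP[s3 S3] x0 xS.
have [xle0|xgt0] := leP x 0.
  by exists 0%N; rewrite !take0 !big_nil //; lra.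
have s_le : (s%:R : rat)^-1 <= 1 / 3.
  by rewrite div1r lef_pV2 ?posrE ?ltr0n ?ler_nat //; apply: leq_trans s3.
have [|| n xn nx] := IHS (x - s%:R^-1) S3; [lra|lra|].
by exists n.+1; rewrite /= big_cons; lra.
Qed.

Lemma card_multiplesI N d e D E : (0 < d)%N -> (0 < e)%N -> coprime d e -> (D < N)%N ->
  (#|multiples N d D :&: multiples N e E|%:R : rat) <= D%:R / (d%:R * e%:R).
Proof.
move=> d0 e0 de DN; rewrite -natrM.
apply: le_trans (_ : (#|multiples N (d * e) D|%:R) <= _).
  rewrite ler_nat; apply/subset_leq_card/subsetP => i; rewrite !inE.
  by case/andP=> /and3P[-> di ->] /and3P[_ ei _]; rewrite Gauss_dvd // di ei.
rewrite card_multiples ?muln_gt0 ?d0 // ler_pdivlMr ?ltr0n ?muln_gt0 ?d0 //.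
by rewrite -natrM ler_nat leq_trunc_div.
Qed.

(** Bonferroni for the multiples of 1, of [q] and of each [s] in [S]. The subtracted terms bound the
    pairwise overlaps of types [(1, q)], [(1, s)], [(q, s)] and [(s, s')], in this order. *)
Lemma union_of_multiples N (U : {set 'I_N}) (q J b X : nat) (S : seq nat) (x : rat) :
  prime q -> all prime S -> uniq S -> q \notin S ->
  (b < N)%N -> (q * J < N)%N -> (X < N)%N ->
  multiples N 1 b \subset U -> multiples N q (q * J) \subset U ->
  (forall s, s \in S -> multiples N s X \subset U) ->
  x = \sum_(s <- S) s%:R^-1 ->
  b%:R + J%:R + (X%:R * x - (size S)%:R) - b%:R / q%:R - b%:R * x - X%:R * x / q%:R
    - X%:R * x ^+ 2 / 2 <= #|U|%:R.
Proof.
move=> qp Sp uS qS bN JN XN bU JU XU xE.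
(* [A] is made empty outside the family because [bonferroni] asks for the inclusion at every
   index. *)
pose D t := if t == 1%N then b else if t == q then (q * J)%N else X.
pose A t := if t \in 1%N :: q :: S then multiples N t (D t) else set0.
have q1 : (q == 1)%N = false by apply/negbTE; move: (prime_gt1 qp); case: eqP => // ->.
have notS t : t \in S -> (t == 1%N = false) * (t == q = false).
  move=> tS; split; apply/negbTE; first by case: eqP tS => // -> /(allP Sp).
  by apply: contraNneq qS => <-.
have AU t : A t \subset U.
  rewrite /A; case: ifPn => [|_]; last exact: sub0set.
  rewrite !inE => /or3P[/eqP->|/eqP->|tS]; rewrite /D ?eqxx ?q1 //.
  by rewrite !notS //; apply: XU.
have A1 : A 1%N = multiples N 1 b by rewrite /A inE eqxx /D eqxx.
have Aq : A q = multiples N q (q * J) by rewrite /A !inE eqxx orbT /D q1 eqxx.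
have As s : s \in S -> A s = multiples N s X.
  by move=> sS; rewrite /A !inE sS !orbT /D !notS.
have q0 := prime_gt0 qp.
have s0 s : s \in S -> (0 < s)%N by move=> /(allP Sp)/prime_gt0.
have cop1 s : coprime 1 s by rewrite coprime1n.
have copq s : s \in S -> coprime q s.
  move=> sS; rewrite prime_coprime // dvdn_prime2 // ?(allP Sp) //.
  by apply: contraNneq qS => ->.
have copS s s' : s \in S -> s' \in S -> s != s' -> coprime s s'.
  by move=> sS s'S ss'; rewrite prime_coprime ?dvdn_prime2 // (allP Sp).
have card1 : #|A 1%N| = b by rewrite A1 card_multiples // divn1.
have cardq : #|A q| = J by rewrite Aq card_multiples // mulKn.
have I1 s : s \in q :: S -> #|A 1%N :&: A s|%:R <= b%:R * s%:R^-1 :> rat.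
  move=> sS; rewrite A1 -[s%:R]mul1r; move: sS; rewrite inE => /predU1P[->|sS].
    by rewrite Aq card_multiplesI.
  by rewrite As //; apply: card_multiplesI => //; apply: s0.
have Iq s : s \in S -> #|A q :&: A s|%:R <= X%:R / q%:R * s%:R^-1 :> rat.
  move=> sS; rewrite setIC Aq As // -mulrA -invfM [q%:R * _]mulrC.
  by apply: card_multiplesI; [apply: s0 | | rewrite coprime_sym copq |].
have IS s s' : s \in S -> s' \in S ->
    #|A s :&: A s'|%:R <= (if s' == s then #|A s|%:R else 0) + X%:R * s%:R^-1 * s'%:R^-1 :> rat.
  move=> sS s'S; case: eqVneq => [->|NE].
    by rewrite setIid lerDl !mulr_ge0 ?invr_ge0 ?ler0n.
  by rewrite add0r !As // -mulrA -invfM; apply: card_multiplesI; rewrite ?s0 // copS // eq_sym.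
have row1 : (\sum_(t <- 1%N :: q :: S) #|A 1%N :&: A t|)%:R <= b%:R + (b%:R / q%:R + b%:R * x) :> rat.
  rewrite !big_cons setIid card1 !natrD lerD2l lerD ?I1 ?mem_head //.
  rewrite xE natr_sum mulr_sumr !big_seq; apply: ler_sum => s sS.
  by rewrite I1 // inE sS orbT.
have rowq : (\sum_(t <- 1%N :: q :: S) #|A q :&: A t|)%:R <= b%:R / q%:R + (J%:R + X%:R / q%:R * x) :> rat.
  rewrite !big_cons setIid cardq !natrD lerD ?lerD2l //.
    by rewrite setIC I1 ?mem_head.
  by rewrite xE natr_sum mulr_sumr !big_seq; apply: ler_sum => s sS; apply: Iq.
have rowS s : s \in S -> (\sum_(t <- 1%N :: q :: S) #|A s :&: A t|)%:R <=
    b%:R * s%:R^-1 + (X%:R / q%:R * s%:R^-1 + (#|A s|%:R + X%:R * s%:R^-1 * x)) :> rat.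
  move=> sS; rewrite !big_cons !natrD !lerD //.
  - by rewrite setIC I1 // inE sS orbT.
  - by rewrite setIC Iq.
  apply: le_trans (_ : \sum_(s' <- S) ((if s' == s then #|A s|%:R else 0) + X%:R * s%:R^-1 * s'%:R^-1) <= _).
    by rewrite natr_sum !big_seq; apply: ler_sum => s' s'S; apply: IS.
  rewrite big_split /= (bigD1_seq s) //= eqxx big1 ?addr0; last first.
    by move=> t /negPf->.
  by rewrite -mulr_sumr xE.
have rows : (\sum_(s <- S) \sum_(t <- 1%N :: q :: S) #|A s :&: A t|)%:R <=
    b%:R * x + (X%:R / q%:R * x + ((\sum_(s <- S) #|A s|)%:R + X%:R * x * x)) :> rat.
  rewrite natr_sum big_seq; apply: le_trans; first by apply: ler_sum; exact: rowS.
  by rewrite -big_seq !big_split /= -mulr_suml -!mulr_sumr -xE natr_sum.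
(* Rounding [X / s] down loses at most 1 for each [s], hence the term [size S]. *)
have cardS : X%:R * x - (size S)%:R <= (\sum_(s <- S) #|A s|)%:R :> rat.
  rewrite xE natr_sum mulr_sumr lerBlDr -sum1_size natr_sum -big_split /= !big_seq.
  apply: ler_sum => s sS; rewrite As // card_multiples ?s0 // natr1.
  by rewrite ler_pdivrMr ?ltr0n ?s0 // -natrM ler_nat ltnW // ltn_ceil ?s0.
have := bonferroni (1%N :: q :: S) AU.
rewrite big_cons [X in (3 * (_ + X))%N]big_cons card1 cardq.
rewrite [X in (_ <= _ + X)%N]big_cons [X in (_ <= _ + (_ + X))%N]big_cons.
move: row1 rowq rows cardS.
move: (\sum_(t <- _ :: _ :: _) #|A 1%N :&: A t|)%N => r1.
move: (\sum_(t <- _ :: _ :: _) #|A q :&: A t|)%N => rq.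
move: (\sum_(s <- S) \sum_(t <- _) _)%N => rS.
move: (\sum_(s <- S) #|A s|)%N => Y.
rewrite -(ler_nat rat) !(natrM, natrD) expr2; move=> h1 h2 h3 h4 h5.
have -> : X%:R * x / q%:R = X%:R / q%:R * x :> rat by rewrite mulrAC.
move: h1 h2 h3 h4 h5; move: (b%:R / q%:R : rat) (X%:R / q%:R : rat) => u v; clear; lra.
Qed.

End Sieves.

(** * The EKG sequence *)

Section EKG.
Variable a : nat -> nat.
Hypothesis ha : is_EKG a.

Definition used t := [seq a k | k <- iota 1 t].

(* The search may stop after [t.+1] multiples of [s], since only [t] terms are present.
   The value is the junk [0] for [s = 0]. *)
Definition least_unused t s :=
  s * (find (fun l => s * l.+1 \notin used t) (iota 0 t.+1)).+1.

(** * Positivity, distinctness and minimality of the terms *)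

Lemma usedP t x : reflect (exists2 k, 1 <= k <= t & a k = x) (x \in used t).
Proof.
apply: (iffP mapP) => [[k]|[k kt <-]]; first by rewrite mem_iota add1n ltnS => kt ->; exists k.
by exists k; rewrite // mem_iota add1n ltnS.
Qed.

Lemma mem_used k t : 1 <= k <= t -> a k \in used t.
Proof. by move=> kt; apply/usedP; exists k. Qed.

Lemma usedS t : used t.+1 = rcons (used t) (a t.+1).
Proof. by rewrite /used -[t.+1 in LHS]addn1 iotaD map_cat cats1. Qed.

Lemma used_mono t t' x : t <= t' -> x \in used t -> x \in used t'.
Proof.
move=> tt' /usedP[k /andP[k1 kt] <-]; apply: mem_used.
by rewrite k1 (leq_trans kt).
Qed.

Lemma EKG_gt0 k : 1 <= k -> 0 < a k.
Proof.
have [a1 a2 aS] := ha; case: k => [|[|[|k]]] // _; rewrite ?a1 ?a2 //.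
by have [[]] := aS k.+3 isT.
Qed.

Lemma EKG_fresh t : 1 <= t -> a t.+1 \notin used t.
Proof.
have [a1 a2 aS] := ha; case: t => [|[|t]] // _.
  by apply/usedP => -[[|[|k]]] //; rewrite a1 a2.
have [[_ H _] _] := aS t.+3 isT.
by apply/usedP => -[k kt /H]; apply; rewrite subn1.
Qed.

Lemma EKG_neq i j : 1 <= i < j -> a i != a j.
Proof.
case: j => [|j] /andP[i1 ij]; first by rewrite ltn0 in ij.
have j1 : 1 <= j := leq_trans i1 ij.
by apply: contraNneq (EKG_fresh j1) => <-; apply: mem_used; rewrite i1.
Qed.

Lemma EKG_inj i j : 1 <= i -> 1 <= j -> a i = a j -> i = j.
Proof.
move=> i1 j1 E; case: (ltngtP i j) => // ij.
  by have := @EKG_neq i j; rewrite i1 ij E eqxx => /(_ isT).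
by have := @EKG_neq j i; rewrite j1 ij E eqxx => /(_ isT).
Qed.

Lemma uniq_used t : uniq (used t).
Proof.
rewrite map_inj_in_uniq ?iota_uniq // => i j.
by rewrite !mem_iota => /andP[i1 _] /andP[j1 _]; apply: EKG_inj.
Qed.

Lemma size_used t : size (used t) = t.
Proof. by rewrite size_map size_iota. Qed.

Lemma EKG_gcd t : 2 <= t -> 1 < gcdn (a t) (a t.+1).
Proof. by case: t => [|[|t]] // _; have [_ _ /(_ t.+3 isT)[[]]] := ha. Qed.

Lemma EKG_min t m : 2 <= t -> 0 < m -> m \notin used t -> 1 < gcdn (a t) m -> a t.+1 <= m.
Proof.
case: t => [|[|t]] // _ m0 mU g; have [_ _ /(_ t.+3 isT)[_]] := ha; apply.
split=> //; rewrite ?subn1 // => k kt akm.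
by case/negP: mU; rewrite -akm mem_used.
Qed.

(** * Least missing multiples and the greedy rule *)

Lemma least_unusedP t s : 0 < s ->
  [/\ 0 < least_unused t s, s %| least_unused t s, least_unused t s \notin used t &
   forall x, 0 < x -> s %| x -> x \notin used t -> least_unused t s <= x].
Proof.
move=> s0; pose p l := s * l.+1 \notin used t.
have hp : has p (iota 0 t.+1).
  rewrite -[has _ _]negbK; apply/negP => /hasPn H.
  have : size [seq s * l.+1 | l <- iota 0 t.+1] <= size (used t).
    apply: uniq_leq_size.
      by rewrite map_inj_uniq ?iota_uniq // => x y /eqP; rewrite eqn_pmul2l // => /eqP[].
    by move=> _ /mapP[l lt ->]; rewrite -[_ \in _]negbK; apply: H.
  by rewrite size_map size_iota size_used ltnn.
split; rewrite /least_unused ?muln_gt0 ?s0 ?dvdn_mulr //.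
  have := nth_find 0 hp; rewrite nth_iota ?add0n //.
  by move: hp; rewrite has_find size_iota.
move=> x x0 /dvdnP[c xE] xU; case: c xE x0 => [|c] xE x0; first by rewrite xE in x0.
rewrite xE mulnC leq_pmul2r // ltnS leqNgt; apply/negP => cf.
have := before_find 0 cf; rewrite nth_iota ?add0n.
  by rewrite mulnC -xE xU.
by apply: leq_trans cf _; rewrite -[X in _ <= X](size_iota 0) find_size.
Qed.

Lemma least_unused_mono t t' s : 0 < s -> t <= t' -> least_unused t s <= least_unused t' s.
Proof.
move=> s0 tt'; have [_ _ _] := least_unusedP t s0; apply; have [//] := least_unusedP t' s0.
by move=> _ _ H _; apply: contra H; apply: used_mono.
Qed.

Lemma lt_least_unused t s x : 0 < s -> 0 < x -> s %| x -> x < least_unused t s -> x \in used t.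
Proof.
move=> s0 x0 sx; rewrite ltnNge; apply: contraR => xU.
by have [_ _ _] := least_unusedP t s0; apply.
Qed.

Lemma EKG_next_le t s : 2 <= t -> 1 < s -> s %| a t -> a t.+1 <= least_unused t s.
Proof.
move=> t2 s1 sa; have [b0 sb bU _] := least_unusedP t (ltnW s1).
apply: EKG_min => //; apply: leq_trans s1 (dvdn_leq _ _); last by rewrite dvdn_gcd sa.
by rewrite gcdn_gt0 b0 orbT.
Qed.

(** The new term is itself a missing multiple of [s], so the bound of [EKG_next_le] is attained. *)
Lemma EKG_next_eq t s : 2 <= t -> 1 < s -> s %| a t -> s %| a t.+1 -> a t.+1 = least_unused t s.
Proof.
move=> t2 s1 sa sa'; apply/eqP; rewrite eqn_leq EKG_next_le //=.
have [_ _ _] := least_unusedP t (ltnW s1); apply => //; first exact: EKG_gt0.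
by apply: EKG_fresh; apply: ltnW.
Qed.

Lemma EKG_common_prime t : 2 <= t -> exists s, [/\ prime s, s %| a t & s %| a t.+1].
Proof.
move=> /EKG_gcd g; exists (pdiv (gcdn (a t) (a t.+1))); rewrite pdiv_prime //.
have := pdiv_dvd (gcdn (a t) (a t.+1)); rewrite dvdn_gcd => /andP[-> ->] //.
Qed.

Lemma EKG_next_gt1 t : 1 <= t -> 1 < a t.+1.
Proof.
have [a1 _ _] := ha; move=> t1; rewrite ltn_neqAle EKG_gt0 // andbT.
by apply/eqP => E; case/negP: (EKG_fresh t1); rewrite -E -a1 mem_used // leqnn.
Qed.

(** * Counting terms through their followers *)

(** The followers are distinct, exceed 1 and avoid [m], so they lie in the interval from 2 to
    [m - 1]. *)
Lemma size_followers t m (K : seq nat) : uniq K -> m \notin used t ->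
  {in K, forall k, (1 <= k < t) && (a k.+1 <= m)} -> size K <= m - 2.
Proof.
move=> uK mU HK; rewrite -(size_map (fun k => a k.+1)) -[leqRHS](size_iota 2).
apply: uniq_leq_size => [|_ /mapP[k kK ->]].
  rewrite map_inj_in_uniq // => i j /HK/andP[/andP[i1 _] _] /HK/andP[/andP[j1 _] _] /EKG_inj E.
  by have [] := E isT isT.
have /andP[/andP[k1 kt] am] := HK k kK.
have : a k.+1 != m by apply: contraNneq mU => <-; apply: mem_used.
by rewrite mem_iota; move: (EKG_next_gt1 k1) am; lia.
Qed.

Lemma least_unused_even_ge2 t : 2 <= least_unused t 2.
Proof. by have [b0 /dvdn_leq H _ _] := least_unusedP t (isT : 0 < 2); apply: H. Qed.

Lemma even_ge2 k : 1 <= k -> ~~ odd (a k) -> 2 <= k.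
Proof. by case: k => [|[|k]] //; have [-> _ _] := ha. Qed.

(** An even term before the last is followed by a number at most [b], so there are at most [b - 2]
    of these. The last term has no follower yet and adds one only if it is even. *)
Lemma count_evens t : 1 <= t ->
  count (predC odd) (used t) < least_unused t 2 - odd (a t).
Proof.
case: t => [|t] // _; have := least_unused_even_ge2 t.+1; set b := least_unused _ _ => b2.
have H : count (predC odd) (used t) <= b - 2.
  rewrite /used count_map -size_filter; apply: (@size_followers t.+1).
  - by rewrite filter_uniq ?iota_uniq.
  - by have [] := least_unusedP t.+1 (isT : 0 < 2).
  move=> k; rewrite mem_filter mem_iota /= => /andP[ek /andP[k1 kt]].
  have kt' : k < t.+1 by rewrite -add1n.
  rewrite k1 kt' /=; apply: leq_trans (@least_unused_mono k t.+1 2 isT (ltnW kt')).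
  by apply: EKG_next_le; [apply: even_ge2 | | rewrite dvdn2].
by rewrite usedS -cats1 count_cat /= addn0; case: (odd _); lia.
Qed.

Lemma card_halves_used N t :
  #|[set i : 'I_N | 2 * i \in used t]| <= count (predC odd) (used t).
Proof.
rewrite -size_filter cardE.
rewrite -(size_map (fun i : 'I_N => 2 * i) (enum _)).
apply: uniq_leq_size => [|x /mapP[i]].
  by rewrite map_inj_uniq ?enum_uniq // => i j /eqP; rewrite eqn_pmul2l // => /eqP/val_inj.
by rewrite mem_enum inE => iU ->; rewrite mem_filter iU andbT /= oddM.
Qed.

(* Some odd prime [s <> p] divides [j], and all multiples of [s] up to [p * j] have appeared. *)
Definition led t p j := has
  (fun s => [&& prime s, odd s, s != p, s %| j & p * j < least_unused t s]) (iota 0 j.+1).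

Lemma ledP t p j : 0 < j -> reflect (exists2 s, prime s /\ odd s &
  [/\ s != p, s %| j & p * j < least_unused t s]) (led t p j).
Proof.
move=> j0; apply: (iffP hasP) => [[s _ /and5P[? ? ? ? ?]]|[s [sp os] [np sj lt]]].
  by exists s.
by exists s; rewrite ?mem_iota ?ltnS ?(dvdn_leq j0 sj) // sp os np sj lt.
Qed.

Lemma used_lt_least t s x : 0 < s -> x \in used t -> x <= least_unused t s ->
  x < least_unused t s.
Proof.
move=> s0 xU; rewrite leq_eqVlt => /predU1P[xE|//].
by have [_ _ /negP] := least_unusedP t s0; rewrite -xE.
Qed.

Lemma reach_cases k t p j : prime p -> 0 < j -> 2 <= k < t -> a k.+1 = p * j ->
  least_unused k 2 < p * j -> led t p j \/
  [/\ p %| a k, odd (a k), least_unused k p = p * j &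
      forall s, prime s -> s %| a k -> p * j <= least_unused k s].
Proof.
move=> pp j0 /andP[k2 kt] ak lt2.
have [s [sp sa sa']] := EKG_common_prime k2.
have E := EKG_next_eq k2 (prime_gt1 sp) sa sa'.
have s2 : s != 2 by apply: contraTneq lt2 => <-; rewrite -E ak ltnn.
have [sEp|np] := eqVneq s p; [right|left].
  rewrite sEp in sa E; split=> //; last 1 first.
  - by move=> r rp ra; rewrite -ak; exact: (EKG_next_le k2 (prime_gt1 rp) ra).
  - have := EKG_next_le k2 (isT : 1 < 2); rewrite dvdn2 ak leqNgt lt2.
    by case: (odd _) => // /(_ isT).
  - by rewrite -E.
apply/ledP => //; exists s.
  by split=> //; have [] := even_prime sp => // sE; rewrite sE in s2.
split=> //.
  by move: sa'; rewrite ak Gauss_dvdr // prime_coprime // dvdn_prime2.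
apply: used_lt_least; rewrite ?prime_gt0 //; first by rewrite -ak; apply: mem_used.
by rewrite -ak E; apply: least_unused_mono; rewrite ?prime_gt0 // ltnW.
Qed.

(** Suppose [b <= p * i] and a prime [s] other than [p] divides [i]. If [i <= j], all multiples of
    [s] below [p * j] are gone, so [s] witnesses [led] for [i]. To get [i <= j] or [led] directly,
    [reach_cases] is applied one step earlier, to the term [p * i]. *)
Lemma pred_cases k t b p j : prime p -> 0 < j -> 2 <= k < t -> a k.+1 = p * j ->
  least_unused k 2 <= b -> b < p * j -> led t p j \/
  exists i, [/\ a k = p * i, odd i, 0 < i & [|| p * i < b, led t p i | p.-nat i && (b <= p * i)]].
Proof.
move=> pp j0 kt ak kb bj; have [k2 kt'] := andP kt.
have [|[pa oa pE pmin]] := reach_cases pp j0 kt ak (leq_ltn_trans kb bj); first by left.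
right; have [i iE] := dvdnP pa; rewrite mulnC in iE; exists i.
have oi : odd i by move: oa; rewrite iE oddM => /andP[].
have i0 : 0 < i := odd_gt0 oi; split=> //.
have [//|bi /=] := ltnP (p * i) b; rewrite andbT.
have [ni|] := boolP (p.-nat i); rewrite ?orbT ?orbF //.
rewrite /pnat i0 => /allPn[s]; rewrite mem_primes => /and3P[sp _ si] np.
have Hij : led t p i \/ i <= j.
  have p0 := prime_gt0 pp.
  have [b2 b2'] : 2 <= least_unused k 2 /\ least_unused k 2 \notin used k.
    by split; [apply: least_unused_even_ge2 | have [] := least_unusedP k (isT : 0 < 2)].
  have bi' : least_unused k 2 < p * i.
    rewrite ltn_neqAle (leq_trans kb) // andbT; apply: contraNneq b2' => ->.
    by rewrite -iE; apply: mem_used => //; rewrite leqnn andbT ltnW.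
  (* The earlier step needs an index at least 2; [k = 2] is excluded because [a 2 = 2] is even. *)
  case: k k2 kt kt' ak kb pa oa pE pmin iE b2 b2' bi' =>
    [|[|[|k]]] // k2 kt kt' ak kb pa oa pE pmin iE b2 b2' bi'.
    by have [_ a2 _] := ha; move: oa; rewrite a2.
  have kk : 2 <= k.+2 < t by rewrite (ltnW kt').
  have lt2 : least_unused k.+2 2 < p * i.
    by apply: leq_ltn_trans bi'; apply: least_unused_mono.
  have [|[_ _ E _]] := reach_cases pp i0 kk iE lt2; first by left.
  by right; rewrite -(leq_pmul2l p0) -E -pE; apply: least_unused_mono.
case: Hij => [//|ij]; apply/ledP => //; exists s.
  by split=> //; apply: dvdn_odd oi.
split=> //; apply: used_lt_least; rewrite ?prime_gt0 //.
  by rewrite -iE; apply: mem_used => //; rewrite (ltnW kt') ltnW.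
apply: leq_trans (least_unused_mono _ (ltnW kt')); rewrite ?prime_gt0 //.
apply: leq_trans (pmin s sp _); first by rewrite leq_pmul2l ?prime_gt0.
by rewrite iE dvdn_mull.
Qed.

(** * The upper bound *)

(* Instances: an odd prime [p] with [e = p] and [v = p.-1], where multiples of [p] are discarded
   because they are counted separately; and [p = 2 * q] with [v = p] and [e = 0], which only
   divides [0] and so discards nothing. *)
Lemma led_sieve t p e v b n (R : seq nat) : 0 < v <= p ->
  (forall N s f, (s == 1) || prime s && (s != p) -> s * (p * f)./2 < N ->
    2 * #|[set i in multiples N s (s * (p * f)./2) | ~~ (e %| i)]| = v * f) ->
  (forall i, 0 < i -> 2 * i < b -> 2 * i \in used t) ->
  (forall N, #|[set i : 'I_N | (2 * i \in used t) && ~~ (e %| i)]| <= n) ->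
  sorted ltn R -> (forall j, j \in R -> 0 < j /\ ((p * j < b) || led t p j)) ->
  3 * v ^ 2 * size R * (size R).+1 <= 8 * p * (2 * size R).+1 * n /\
  (all odd R -> v ^ 2 * size R <= 4 * p * n).
Proof.
move=> /andP[v0 vp] cardX usedb cardn sR HR.
have p0 : 0 < p := leq_trans v0 vp.
(* Label 1 is given to the [j] with [p * j < b], with threshold [b]; any other [j] is labelled by a
   prime witnessing [led]. *)
pose tau s := if s == 1 then b else least_unused t s.
pose c j := if p * j < b then 1 else head 0 [seq s <- iota 0 j.+1 |
  [&& prime s, odd s, s != p, s %| j & p * j < least_unused t s]].
pose f s := (tau s).-1 %/ (p * s).
have cP j : j \in R -> [/\ (c j == 1) || prime (c j) && (c j != p), c j %| j & p * j < tau (c j)].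
  move=> /HR[j0]; rewrite /c; case: ifP => [jb _|_]; first by rewrite /tau eqxx dvd1n.
  rewrite /= /led has_filter; set l := filter _ _ => l0.
  have : head 0 l \in l by case: (l) l0 => //= x l' _; rewrite mem_head.
  rewrite {2}/l mem_filter => /andP[/and5P[sp _ np sj lt] _].
  rewrite sp np orbT sj /tau; case: eqP => // E.
  by rewrite E in sp.
have c0 j : j \in R -> 0 < c j.
  by move=> /cP[/orP[/eqP->|/andP[/prime_gt0 ? _]]].
have jf j : j \in R -> j <= c j * f (c j).
  move=> jR; have [_ /dvdnP[i ji] lt] := cP j jR; have cj0 := c0 j jR.
  rewrite {1}ji mulnC leq_pmul2l // /f leq_divRL ?muln_gt0 ?p0 //.
  by rewrite mulnCA -ji; move: lt; case: (tau _).
have f0 j : j \in R -> 0 < f (c j).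
  by move=> jR; have := jf j jR; have [j0 _] := HR j jR; case: (f _); rewrite ?muln0 // leqNgt j0.
pose M := \sum_(j <- R) c j * (p * f (c j))./2.
have MP j : j \in R -> c j * (p * f (c j))./2 < M.+1.
  by move=> jR; rewrite ltnS /M (big_rem j) //= leq_addr.
pose N := M.+1.
(* For a label [s], [s * p * f s < tau s], so [2 * i] has appeared for every [i] in [X s]. *)
pose X s := [set i in multiples N s (s * (p * f s)./2) | ~~ (e %| i)].
pose A := [set i : 'I_N | (2 * i \in used t) && ~~ (e %| i)].
have cX j : j \in R -> 2 * #|X (c j)| = v * f (c j).
  by move=> jR; apply: cardX; [have [] := cP j jR | apply: MP].
have XA j : j \in R -> X (c j) \subset A.
  move=> jR; have [cj _ _] := cP j jR; have cj0 := c0 j jR.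
  apply/subsetP => i; rewrite !inE => /andP[/and3P[i0 ci iD] ->]; rewrite andbT.
  have lt : 2 * i < tau (c j).
    have H : p * c j * f (c j) <= (tau (c j)).-1 by rewrite mulnC leq_trunc_div.
    have [_ _ jt] := cP j jR.
    have : 2 * i <= c j * (p * f (c j)).
      apply: leq_trans (_ : 2 * (c j * (p * f (c j))./2) <= _); first by rewrite leq_pmul2l.
      by rewrite mulnCA leq_pmul2l // -[leqRHS]odd_double_half mul2n leq_addl.
    by move: jt H; rewrite mulnA [c j * p]mulnC; lia.
  move: lt; rewrite /tau; case: eqP => [_|_]; first exact: usedb.
  by apply: lt_least_unused; rewrite ?muln_gt0 ?i0 ?dvdn_mull.
have cardXX i j : i \in R -> j \in R -> c i != c j ->
    2 * (#|X (c i) :&: X (c j)| * c j) <= p * f (c i).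
  move=> iR jR cij; have ci0 := c0 i iR; have cj0 := c0 j jR.
  have cop : coprime (c i) (c j).
    have [H _ _] := cP i iR; have [H' _ _] := cP j jR.
    case/orP: H => [/eqP->|/andP[ip _]]; first exact: coprime1n.
    case/orP: H' => [/eqP->|/andP[jp _]]; first exact: coprimen1.
    by rewrite prime_coprime // dvdn_prime2.
  have H : #|X (c i) :&: X (c j)| <= (p * f (c i))./2 %/ c j.
    rewrite -(@divnMl (c i)) // -(@card_multiples N) ?muln_gt0 ?ci0 ?MP //.
    apply/subset_leq_card/subsetP => k; rewrite !inE.
    by case/andP=> /andP[/and3P[-> ck ->] _] /andP[/and3P[_ ck' _] _]; rewrite Gauss_dvd // ck ck'.
  rewrite leq_divRL // in H.
  apply: leq_trans (_ : 2 * (p * f (c i))./2 <= _); first by rewrite leq_pmul2l.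
  by rewrite mul2n -[leqRHS]odd_double_half leq_addl.
have nA : (#|A| <= n) by apply: cardn.
(* As [#|X s| = v * f s / 2] and an overlap has at most [p * f (c i) / (2 * c j)] elements,
   [l = v^2 / (2 * p)] is exactly what the overlap condition of [rank_sieve] allows; the size
   condition then follows from [v <= p]. *)
have l0 : (0 < (v%:R ^+ 2 / (2 * p%:R) : rat))%R.
  by rewrite divr_gt0 ?exprn_gt0 ?mulr_gt0 ?ltr0n.
have [||||H1 H2] := @rank_sieve N R c f X A _ l0 sR.
- move=> j jR; have [j0 _] := HR j jR; have [_ cj _] := cP j jR.
  by rewrite j0 c0 // cj jf.
- exact: XA.
- move=> j jR; have := cX j jR.
  move=> /(congr1 (fun k => k%:R : rat))%R; rewrite !natrM => E.
  have -> : (#|X (c j)|%:R = v%:R * (f (c j))%:R / 2 :> rat)%R by rewrite -E; field.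
  rewrite mulrAC ler_pdivrMr ?mulr_gt0 ?ltr0n // -subr_ge0.
  have -> : (v%:R * (f (c j))%:R / 2 * (2 * p%:R) - v%:R ^+ 2 * (f (c j))%:R =
            v%:R * (f (c j))%:R * (p%:R - v%:R) :> rat)%R by field.
  by rewrite !mulr_ge0 // subr_ge0 ler_nat.
- move=> i j iR jR cij; have := cardXX i j iR jR cij; rewrite -(ler_nat rat) !natrM.
  have := cX i iR; move=> /(congr1 (fun k => k%:R : rat))%R; rewrite !natrM => Ei.
  have := cX j jR; move=> /(congr1 (fun k => k%:R : rat))%R; rewrite !natrM => Ej.
  have -> : (#|X (c i)|%:R = v%:R * (f (c i))%:R / 2 :> rat)%R by rewrite -Ei; field.
  have -> : (#|X (c j)|%:R = v%:R * (f (c j))%:R / 2 :> rat)%R by rewrite -Ej; field.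
  set y := (#|_|%:R)%R; move=> H.
  have pp : (0 < 2 * p%:R :> rat)%R by rewrite mulr_gt0 ?ltr0n.
  have -> : (v%:R ^+ 2 / (2 * p%:R) * y * ((c j)%:R * (f (c j))%:R) =
    (v%:R ^+ 2 * (f (c j))%:R / 2) * ((2 * (y * (c j)%:R)) / (2 * p%:R)) :> rat)%R.
    by field; rewrite pnatr_eq0 -lt0n.
  have -> : (v%:R * (f (c i))%:R / 2 * (v%:R * (f (c j))%:R / 2) =
    (v%:R ^+ 2 * (f (c j))%:R / 2) * ((f (c i))%:R / 2) :> rat)%R by field.
  apply: ler_wpM2l; first by rewrite divr_ge0 ?mulr_ge0 ?sqr_ge0.
  rewrite ler_pdivrMr //; apply: le_trans H _.
  by rewrite le_eqVlt; apply/orP; left; apply/eqP; field.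
have p0' : (0 < p%:R :> rat)%R by rewrite ltr0n.
have nA' : (#|A|%:R <= n%:R :> rat)%R by rewrite ler_nat.
have r0 : (0 <= (size R)%:R :> rat)%R by [].
have pn : (p%:R != 0 :> rat)%R by apply: lt0r_neq0.
have dp : (0 <= 2 * p%:R :> rat)%R by rewrite mulr_ge0.
split=> [|/H2 {H1}H1]; have := ler_wpM2r dp H1; rewrite -(ler_nat rat) !natrM.
  rewrite -[((size R).+1)%:R%R]natr1 -[((2 * size R).+1)%:R%R]natr1 natrM => H.
  apply: le_trans (_ : 4 * (2 * (size R)%:R + 1) * #|A|%:R * (2 * p%:R) <= _)%R.
    by apply: le_trans H; rewrite le_eqVlt; apply/orP; left; apply/eqP; field.
  have : (0 <= (2 * (size R)%:R + 1) * p%:R :> rat)%R by rewrite mulr_ge0 // addr_ge0 // mulr_ge0.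
  by move=> /ler_wpM2l /(_ _ _ nA'); lra.
move=> H; apply: le_trans (_ : 2 * #|A|%:R * (2 * p%:R) <= _)%R.
  by apply: le_trans H; rewrite le_eqVlt; apply/orP; left; apply/eqP; field.
by have := ler_wpM2l (ltW p0') nA'; lra.
Qed.

(** With [p = 2 * q + 1], the number [L] of multiples is [q * f + f./2], and exactly [f./2] of them
    are divisible by [p]. *)
Lemma card_prime_to_multiples N p s f : prime p -> odd p -> (s == 1) || prime s && (s != p) ->
  s * (p * f)./2 < N ->
  2 * #|[set i in multiples N s (s * (p * f)./2) | ~~ (p %| i)]| = p.-1 * f.
Proof.
move=> pp op Hs; set L := (p * f)./2 => LN.
have p0 := prime_gt0 pp.
have s0 : 0 < s by case/orP: Hs => [/eqP->|/andP[/prime_gt0]].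
have cop : coprime s p.
  case/orP: Hs => [/eqP->|/andP[sp np]]; first exact: coprime1n.
  by rewrite prime_coprime // dvdn_prime2.
have -> : [set i in multiples N s (s * L) | ~~ (p %| i)] =
    multiples N s (s * L) :\: multiples N (s * p) (s * L).
  apply/setP => i; rewrite !inE Gauss_dvd //.
  by case: (0 < i); case: (s %| i); case: (p %| i); case: (i <= _).
rewrite cardsD (setIidPr _); last first.
  apply/subsetP => i; rewrite !inE Gauss_dvd // => /and3P[-> /andP[-> _] ->] //.
rewrite !card_multiples ?muln_gt0 ?s0 // mulKn // divnMl //.
have [q pE] : exists q, p = q.*2.+1 by exists p./2; rewrite -[LHS]odd_double_half op.
have E : L = q * f + f./2.
  by rewrite /L pE mulSn -doubleMl halfD odd_double andbF add0n doubleK addnC.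
have -> : L %/ p = f./2.
  by rewrite /L -divn2 -divnMA [2 * p]mulnC divnMA mulKn // divn2.
by rewrite E addnK pE /= mulnA mul2n.
Qed.

(** * Terms are at most ten times the least missing even number *)

Lemma index_used t x : x \in used t -> a (index x (used t)).+1 = x /\ index x (used t) < t.
Proof.
move=> xU; have lt : index x (used t) < t by rewrite -[X in _ < X](size_used t) index_mem.
split=> //; rewrite -[RHS](nth_index 0 xU) /used (nth_map 0) ?size_iota //.
by rewrite nth_iota.
Qed.

(** Halves of used even numbers include all [i] below [b / 2] and the multiples of [p] below
    [x / 2]. Their union has fewer than [b - 1] elements, which gives [x < (p + 1) * b], enough for
    [p] = 3, 5, 7. *)
Lemma growth_small_prime t p : 2 <= t -> odd (a t) -> prime p -> p < 11 ->
  odd p -> a t.+1 = least_unused t p -> a t.+1 <= 10 * least_unused t 2.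
Proof.
move=> t2 oa pp p11 op xE; set b := least_unused t 2.
have [b0 b2 bU _] := least_unusedP t (isT : 0 < 2).
have E := count_evens (ltnW t2); rewrite oa -/b in E.
set x := a t.+1 in xE *.
have p0 := prime_gt0 pp.
pose N := b + x; pose A := [set i : 'I_N | 2 * i \in used t].
have A1 : multiples N 1 (b./2).-1 \subset A.
  apply/subsetP => i; rewrite !inE => /and3P[i0 _ ib].
  by apply: (lt_least_unused (s := 2)); rewrite ?muln_gt0 ?i0 ?dvdn_mulr //; move: ib; rewrite -/b; lia.
have A2 : multiples N p (x.-1)./2 \subset A.
  apply/subsetP => i; rewrite !inE => /and3P[i0 pi ib].
  by apply: (lt_least_unused (s := p)); rewrite ?muln_gt0 ?i0 ?dvdn_mull // -xE; lia.
have := subset_leq_card (introT subUsetP (conj A1 A2)); rewrite cardsU.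
have x0 : 0 < x by apply: EKG_gt0.
rewrite !card_multiples //; try (rewrite /N; lia).
have : #|multiples N 1 (b./2).-1 :&: multiples N p (x.-1)./2| <= (b./2).-1 %/ p.
  rewrite -(@card_multiples N) //; last by rewrite /N; lia.
  by apply/subset_leq_card/subsetP => i; rewrite !inE => /andP[/and3P[-> _ ->] /and3P[_ -> _]].
have := card_halves_used N t; rewrite -/A; move: E.
have [c bE] : exists c, b = c.*2.+2.
  by exists b./2.-1; move: b0 b2; rewrite dvdn2 -/b; lia.
rewrite divn1; move: #|_ :&: _| #|A| (count _ _) => I n e.
rewrite bE; have -> : c.*2.+2./2.-1 = c by lia.
move: op p11 pp; case: p {p0 A2 xE} => [|[|[|[|[|[|[|[|[|[|[|p]]]]]]]]]]] //; lia.
Qed.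

(** The first hypotheses give [10 * p * n < (p - 1)^2 * w]. Hence [ro < 2 * w / 5], while [r] is at
    most about [8 * w / 15]. These proportions add up to less than 1, so the single exception [e]
    can matter only for [r <= 3]; the conditions on small [w] settle those cases. *)
Lemma sieve_contradiction p w b n r ro e : 0 < p -> 0 < w -> 10 * b < p * w ->
  2 * n + w < 2 * b -> w <= r + ro + e -> e <= 1 -> e < w -> (w <= 3 -> ro = 0) ->
  3 * p.-1 ^ 2 * r * r.+1 <= 8 * p * (2 * r).+1 * n -> p.-1 ^ 2 * ro <= 4 * p * n -> False.
Proof.
case: p => // p _ w0 bw nb wr e1 ew ro0; rewrite /= => H1 H2.
have K : 10 * p.+1 * n < w * p ^ 2.
  have : 10 * p.+1 * n + 5 * p.+1 * w.+1 <= 10 * p.+1 * b by nia.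
  have : p.+1 * (10 * b) < p.+1 * (p.+1 * w) by rewrite ltn_pmul2l.
  nia.
have p2 : 0 < p ^ 2 by case: (p ^ 2) K => //; rewrite muln0.
have Kro : 5 * ro < 2 * w.
  rewrite -(ltn_pmul2l p2); nia.
have Kr : 0 < r -> 15 * r * r.+1 < 4 * w * (2 * r).+1.
  move=> r0; rewrite -(ltn_pmul2l p2).
  have : (2 * r).+1 * (10 * p.+1 * n) < (2 * r).+1 * (w * p ^ 2) by rewrite ltn_pmul2l.
  nia.
have r3 : r <= 3 by rewrite leqNgt; apply/negP => r3; have := Kr (ltnW (ltnW (ltnW r3))); nia.
move: r3 Kr wr; case: r H1 => [|[|[|[|r]]]] // _ _;
  [move=> _ | move=> /(_ isT) | move=> /(_ isT) | move=> /(_ isT)];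
  move: ro0 Kro e1 ew; clear; lia.
Qed.

Lemma EKG_growth t : 1 <= t -> a t.+1 <= 10 * least_unused t 2.
Proof.
elim/ltn_ind: t => t IH t1; have [b0 b2 bU _] := least_unusedP t (isT : 0 < 2).
have bge2 := least_unused_even_ge2 t.
have [-> | tgt1] : t = 1 \/ 2 <= t by case: t t1 {IH b0 b2 bU bge2} => [|[|t]] //; [left|right].
  have [_ -> _] := ha; have := least_unused_even_ge2 1; lia.
set b := least_unused t 2 in b0 b2 bU bge2 *.
have bound x : x \in used t -> x <= 10 * b.
  case/usedP=> k /andP[k1 kt] <-; case: k k1 kt => // -[|k] _ kt.
    by have [-> _ _] := ha; lia.
  apply: leq_trans (IH _ kt isT) _; rewrite leq_pmul2l //.
  by apply: least_unused_mono => //; apply: ltnW.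
have [//|lt] := leqP (a t.+1) (10 * b); exfalso.
have [p [pp pa pa']] := EKG_common_prime tgt1.
have xE := EKG_next_eq tgt1 (prime_gt1 pp) pa pa'.
have oa : odd (a t).
  have := EKG_next_le tgt1 (isT : 1 < 2); rewrite dvdn2 -/b; case: (odd _) => // /(_ isT); lia.
have op : odd p by apply: dvdn_odd pa oa.
have p0 := prime_gt0 pp.
have [p11|p11] := ltnP p 11.
  by have := growth_small_prime tgt1 oa pp p11 op xE; rewrite leqNgt lt.
have E := count_evens t1; rewrite oa -/b in E.
have [w wE] := dvdnP pa'; rewrite mulnC in wE.
have w0 : 0 < w by case: w wE => // wE; move: lt; rewrite wE muln0.
rewrite wE in lt.
have multU j : 0 < j <= w -> p * j \in used t.+1.
  move=> /andP[j0]; rewrite leq_eqVlt => /predU1P[->|jw].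
    by rewrite -wE; apply: mem_used; rewrite /= leqnn.
  apply: (used_mono (leqnSn t)); apply: (lt_least_unused (s := p)); rewrite ?muln_gt0 ?p0 ?dvdn_mulr //.
  by rewrite -xE wE ltn_pmul2l.
(* [R] feeds the general sieve bound and its odd part [Ro] the stronger odd one; [Exc] collects the
   powers of [p] left over by [pred_cases]. *)
pose P j := (p * j < b) || led t.+1 p j.
pose R := [seq j <- iota 1 w | P j].
pose NR := [seq j <- iota 1 w | ~~ P j].
pose Ro := [seq i <- R | odd i && (i < w)].
pose Exc := [seq i <- iota 1 w.-1 | p.-nat i && (b <= p * i)].
(* For [j] in [NR] the term before [p * j] is [p * g j], and distinct terms have distinct
   predecessors, so [g] injects [NR] into [Ro ++ Exc]. *)
pose g j := a (index (p * j) (used t.+1)) %/ p.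
have sizeRN : size R + size NR = w.
  by rewrite -[RHS](size_iota 1) /R /NR !size_filter count_predC.
have gP j : j \in NR -> let k := index (p * j) (used t.+1) in
    [/\ 0 < k, a k = p * g j & g j \in Ro ++ Exc].
  rewrite mem_filter mem_iota add1n ltnS => /andP[Pj jw].
  set k := index _ _; have [j0 _] := andP jw.
  have [ak kt] := index_used (multU j jw); rewrite -/k in ak kt.
  have [bj nled] : b <= p * j /\ ~~ led t.+1 p j by move: Pj; rewrite negb_or -leqNgt => /andP[].
  have bj' : b < p * j.
    rewrite ltn_neqAle bj andbT; apply/eqP => bE.
    move: (multU j jw); rewrite -bE usedS mem_rcons inE (negPf bU) orbF wE => /eqP; lia.
  have k2 : 2 <= k.
    have [a1 a2 _] := ha; case: k ak {kt} => [|[|k]] //; rewrite ?a1 ?a2; nia.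
  have kt2 : 2 <= k < t.+1 by rewrite k2.
  have kb : least_unused k 2 <= b by apply: least_unused_mono.
  have [H|[i [aki oi i0 Hi]]] := pred_cases pp j0 kt2 ak kb bj'.
    by rewrite H in nled.
  have gi : g j = i by rewrite /g -/k aki mulKn.
  rewrite gi /=; split=> //; first exact: ltnW.
  (* By the induction hypothesis the predecessor [p * i] is at most [10 * b], which is below
     [p * w]. *)
  have iw : i < w.
    rewrite -(ltn_pmul2l p0); apply: leq_ltn_trans lt; apply: bound.
    by rewrite -aki; apply: mem_used; rewrite (ltnW k2).
  have [c1 c2] : i \in iota 1 w /\ i \in iota 1 w.-1 by rewrite !mem_iota; split; lia.
  rewrite mem_cat !mem_filter c1 c2 oi iw /P !andbT /=.
  by case/or3P: Hi => ->; rewrite ?orbT.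
have size_NR : size NR <= size Ro + size Exc.
  rewrite -size_cat -(size_map g); apply: uniq_leq_size => [|_ /mapP[j /gP[_ _ ?] ->] //].
  rewrite map_inj_in_uniq ?filter_uniq ?iota_uniq // => j j' jN j'N gE.
  have [k0 ak _] := gP j jN; have [k0' ak' _] := gP j' j'N.
  have kE : index (p * j) (used t.+1) = index (p * j') (used t.+1).
    by apply: EKG_inj => //; rewrite ak ak' gE.
  have NU i : i \in NR -> p * i \in used t.+1.
    by rewrite mem_filter mem_iota add1n ltnS => /andP[_]; apply: multU.
  have [E1 _] := index_used (NU j jN); have [E2 _] := index_used (NU j' j'N).
  by apply/eqP; rewrite -(eqn_pmul2l p0) -E1 -E2 kE.
(* Two different powers of [p] differ by a factor at least [p >= 11], too much for [p * i] to stay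
   between [b] and [10 * b]. *)
have size_Exc : size Exc <= 1.
  have HE i : i \in Exc -> [/\ p.-nat i, b <= p * i & p * i <= 10 * b].
    rewrite mem_filter mem_iota => /andP[/andP[-> ->] iw]; split=> //; apply: bound.
    apply: (lt_least_unused (s := p)); rewrite ?muln_gt0 ?p0 ?dvdn_mulr //; first by case/andP: iw.
    by rewrite -xE wE ltn_pmul2l //; lia.
  have Heq i i' : i \in Exc -> i' \in Exc -> i' <= i.
    move=> /HE[/p_natP[e ie] bi _] /HE[/p_natP[e' ie'] _ bi'].
    rewrite ie ie' leq_exp2l ?prime_gt1 // leqNgt; apply/negP => ee.
    have : p * p ^ e <= p ^ e' by rewrite -expnS leq_exp2l ?prime_gt1.
    rewrite -ie -ie' => H; move: bi bi' p11 H b0; clear; nia.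
  have uE : uniq Exc by rewrite filter_uniq ?iota_uniq.
  move: Heq uE {HE}; move: (Exc) => [|i [|i' l]] //= Heq /andP[ii' _].
  have H1 : i' <= i by apply: Heq; rewrite !inE eqxx ?orbT.
  have H2 : i <= i' by apply: Heq; rewrite !inE eqxx ?orbT.
  by move: ii'; rewrite inE (eqP (_ : i == i')) ?eqxx // eqn_leq H1 H2.
have size_Exc' : size Exc < w.
  apply: leq_ltn_trans (_ : w.-1 < w); last by rewrite prednK.
  by rewrite -[leqRHS](size_iota 1) size_filter count_size.
have ledR j : j \in R -> 0 < j /\ ((p * j < b) || led t.+1 p j).
  by rewrite mem_filter mem_iota => /andP[Pj /andP[j0 _]].
have sR : sorted ltn R by apply: sorted_filter (iota_ltn_sorted _ _); apply: ltn_trans.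
have sRo : sorted ltn Ro by apply: sorted_filter sR; apply: ltn_trans.
have ledRo j : j \in Ro -> 0 < j /\ ((p * j < b) || led t.+1 p j).
  by rewrite mem_filter => /andP[_]; apply: ledR.
have oddRo : all odd Ro by apply/allP => j; rewrite mem_filter => /andP[/andP[]].
(* Fewer than [b] even numbers are used, and at least [w./2] of them, namely [2 * p * l] with
   [l <= w./2], are multiples of [p]. *)
pose n := (2 * b - w - 1)./2.
pose F := [seq x <- used t.+1 | ~~ odd x].
have sizeF : size F < b.
  have Ec : count (fun x => ~~ odd x) (used t) < b - 1 := E.
  rewrite size_filter usedS -cats1 count_cat /= addn0; move: Ec.
  by move: (count _ _) => m; case: (odd _) => /=; lia.
have F1 : w./2 <= count (dvdn p) F.
  have -> : w./2 = size [seq 2 * p * l | l <- iota 1 w./2] by rewrite size_map size_iota.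
  rewrite -size_filter; apply: uniq_leq_size.
    by rewrite map_inj_uniq ?iota_uniq // => x y /eqP; rewrite eqn_pmul2l ?muln_gt0 // => /eqP.
  move=> _ /mapP[l lw ->]; rewrite !mem_filter -mulnA oddM /= mulnCA dvdn_mulr //=.
  by rewrite multU // muln_gt0 /=; move: lw; rewrite mem_iota; lia.
have cardn N : #|[set i : 'I_N | (2 * i \in used t.+1) && ~~ (p %| i)]| <= n.
  apply: leq_trans (_ : count (predC (dvdn p)) F <= _).
    rewrite -size_filter cardE -(size_map (fun i : 'I_N => 2 * i) (enum _)).
    apply: uniq_leq_size => [|x /mapP[i]].
      by rewrite map_inj_uniq ?enum_uniq // => i j /eqP; rewrite eqn_pmul2l // => /eqP/val_inj.
    rewrite mem_enum inE => /andP[iU pi] ->; rewrite !mem_filter iU oddM /= andbT.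
    by rewrite Gauss_dvdr // coprimen2 op.
  by move: (count_predC (dvdn p) F) F1 sizeF; rewrite /n; lia.
have halves i : 0 < i -> 2 * i < b -> 2 * i \in used t.+1.
  move=> i0 ib; apply: (used_mono (leqnSn t)).
  by apply: (lt_least_unused (s := 2)); rewrite ?muln_gt0 ?i0 ?dvdn_mulr.
have v0 : 0 < p.-1 <= p by lia.
have cardX N s f : (s == 1) || prime s && (s != p) -> s * (p * f)./2 < N ->
  2 * #|[set i in multiples N s (s * (p * f)./2) | ~~ (p %| i)]| = p.-1 * f.
  exact: card_prime_to_multiples.
have [H1 _] := led_sieve v0 cardX halves cardn sR ledR.
have [_ /(_ oddRo) H2] := led_sieve v0 cardX halves cardn sRo ledRo.
have wb : w < 2 * b by move: (count_size (dvdn p) F) F1 sizeF; lia.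
have nb : 2 * n + w < 2 * b by rewrite /n; lia.
have wR : w <= size R + size Ro + size Exc by rewrite -sizeRN -addnA leq_add2l.
(* For [w <= 3] only 1 could lie in [Ro]; but no prime divides 1, and [p < b] contradicts
   [10 * b < p * w]. *)
apply: (sieve_contradiction p0 w0 lt nb wR size_Exc size_Exc' _ H1 H2) => w3.
case El : Ro => [//|i l]; exfalso.
have : i \in Ro by rewrite El mem_head.
rewrite mem_filter => /andP[/andP[oi iw] iR]; have [i0 Pi] := ledR i iR.
have i1 : i = 1 by move: oi iw i0 w3; case: i {El iR Pi} => [|[|[|[|i]]]] //; lia.
case/orP: Pi => [|/ledP[|s [sp _] [_ s1 _]]] //; first by rewrite i1; nia.
by move: s1 sp; rewrite i1 dvdn1 => /eqP->.
Qed.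

(** * The lower bound *)

Lemma used_le t x : x \in used t -> x <= 10 * least_unused t 2.
Proof.
case/usedP=> -[|[|k]] // /andP[_ kt] <-.
  by have [-> _ _] := ha; have := least_unused_even_ge2 t; lia.
apply: leq_trans (EKG_growth (isT : 1 <= k.+1)) _; rewrite leq_pmul2l //.
by apply: least_unused_mono => //; apply: ltnW.
Qed.

(** The odd terms are distinct and at most [10 * b], so there are at most [5 * b] of them; fewer
    than [b] terms are even. *)
Lemma index_lt_least t : 1 <= t -> t < 6 * least_unused t 2.
Proof.
move=> t1; have E := count_evens t1; set b := least_unused t 2 in E *.
have O : count odd (used t) <= 5 * b.
  rewrite -size_filter -[leqRHS](size_iota 0) -(size_map (fun i => i.*2.+1) (iota _ _)).
  apply: uniq_leq_size => [|x]; first by rewrite filter_uniq ?uniq_used.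
  rewrite mem_filter => /andP[ox /used_le xb]; apply/mapP; exists x./2.
    by rewrite mem_iota; move: xb ox; rewrite -/b; lia.
  by move: ox; lia.
by have := count_predC odd (used t); rewrite size_used; lia.
Qed.

Lemma least_unused0 : least_unused 0 2 = 2.
Proof. by []. Qed.

(** When the least missing even number first reaches [y], the term just placed is its previous
    value. The condition [2 < y] excludes [t = 0]. *)
Lemma last_even y t : 2 < y -> y <= least_unused t 2 -> exists T,
  [/\ T < t, a T.+1 = least_unused T 2, a T.+1 < y & y <= least_unused T.+1 2].
Proof.
move=> y2; elim: t => [|t IHt] yt; first by move: yt; rewrite least_unused0 leqNgt y2.
have [/IHt[T [Tt *]]|ty] := leqP y (least_unused t 2).
  by exists T; split=> //; apply: ltnW.
suff E : a t.+1 = least_unused t 2 by exists t; split; rewrite ?E.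
have [b0 b2 bU _] := least_unusedP t (isT : 0 < 2).
have : least_unused t 2 \in used t.+1.
  by apply: (lt_least_unused (s := 2)) => //; apply: leq_trans ty yt.
by rewrite usedS mem_rcons inE (negPf bU) orbF => /eqP.
Qed.

(** [led_sieve] is used with [2 * q] for [p]. A used [2 * q * j] above [b] was reached through a
    prime other than 2, and other than [q] since [m < b] is still a missing multiple of [q]; so [j]
    is led. The constant comes from [b <= 5 * m] and [2 * r + 1 < 2 * (r + 1)]. *)
Lemma early_multiples_lt T q m k J : prime q -> odd q -> m = q * k -> 0 < k -> 1 <= T ->
  m \notin used T -> m < least_unused T 2 -> least_unused T 2 < 5 * m ->
  3 * count (fun j => 2 * q * j \in used T) (iota 1 J) < 40 * k.
Proof.
move=> qp oq mE k0 T1 mU mb b5; set b := least_unused T 2 in mb b5.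
have E := count_evens T1; rewrite -/b in E.
have q0 := prime_gt0 qp.
pose R := [seq j <- iota 1 J | 2 * q * j \in used T].
have sR : sorted ltn R by apply: sorted_filter (iota_ltn_sorted _ _); apply: ltn_trans.
have v0 : 0 < 2 * q <= 2 * q by rewrite muln_gt0 q0 /=.
have q3 : 2 < q by move: (prime_gt1 qp) oq; case: (q) => [|[|[|]]].
have cardX N s f : (s == 1) || prime s && (s != 2 * q) -> s * (2 * q * f)./2 < N ->
    2 * #|[set i in multiples N s (s * (2 * q * f)./2) | ~~ (0 %| i)]| = 2 * q * f.
  have -> : (2 * q * f)./2 = q * f by rewrite -mulnA mul2n doubleK.
  move=> Hs lt; have s0 : 0 < s by case/orP: Hs => [/eqP->|/andP[/prime_gt0]].
  rewrite -mulnA -[in RHS](mulKn (q * f) s0) -(card_multiples s0 lt); congr (2 * _).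
  by apply: eq_card => i; rewrite !inE dvd0n; case: (i : nat) => [|?]; rewrite ?andbT.
have halves i : 0 < i -> 2 * i < b -> 2 * i \in used T.
  by move=> i0 ib; apply: (lt_least_unused (s := 2)); rewrite ?muln_gt0 ?i0 ?dvdn_mulr.
have cardn N : #|[set i : 'I_N | (2 * i \in used T) && ~~ (0 %| i)]| <= b.-1.
  apply: leq_trans (_ : #|[set i : 'I_N | 2 * i \in used T]| <= _).
    by apply/subset_leq_card/subsetP => i; rewrite !inE => /andP[].
  by apply: leq_trans (card_halves_used N T) _; lia.
have ledR j : j \in R -> 0 < j /\ ((2 * q * j < b) || led T (2 * q) j).
  rewrite mem_filter mem_iota => /andP[jU /andP[j0 _]]; split=> //.
  have [//|bj /=] := ltnP; have bj' : b < 2 * q * j.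
    rewrite ltn_neqAle bj andbT; apply: contraTneq jU => <-.
    by have [] := least_unusedP T (isT : 0 < 2).
  have [k' k't ak] : exists2 k', 2 <= k' < T & a k'.+1 = 2 * q * j.
    have [a1 a2 _] := ha.
    case/usedP: jU => -[|[|[|k']]] // kT ak; first by move: ak; rewrite a1; nia.
      by move: ak; rewrite a2; nia.
    by exists k'.+2.
  have [k2 kT] := andP k't.
  have [s [sp sa sa']] := EKG_common_prime k2.
  have sE := EKG_next_eq k2 (prime_gt1 sp) sa sa'.
  have s2 : s != 2.
    apply: contraTneq bj' => s2; rewrite -leqNgt -ak sE s2.
    by apply: least_unused_mono => //; apply: ltnW.
  have sq : s != q.
    apply: contraTneq mb => sq; rewrite -leqNgt; apply: leq_trans (ltnW bj') _.
    rewrite -ak sE sq; have [_ _ _] := least_unusedP k' q0; apply.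
    - by rewrite mE muln_gt0 q0.
    - by rewrite mE dvdn_mulr.
    - by apply: contra mU; apply: used_mono; apply: ltnW.
  have os : odd s by have [] := even_prime sp => // sE'; rewrite sE' in s2.
  apply/ledP => //; exists s => //; split.
  - by apply: contraTneq os => ->; rewrite oddM.
  - move: sa'; rewrite ak -mulnA Gauss_dvdr ?Gauss_dvdr // ?coprimen2 //.
    by rewrite prime_coprime // dvdn_prime2.
  apply: used_lt_least; rewrite ?prime_gt0 //.
  by rewrite -ak sE; apply: least_unused_mono; rewrite ?prime_gt0 // ltnW.
have [H _] := led_sieve v0 cardX halves cardn sR ledR.
rewrite -size_filter -/R; move: (size R) H => r H.
have : 3 * q * r * r.+1 <= 4 * (2 * r).+1 * b.-1.
  by rewrite -(@leq_pmul2l (4 * q)) ?muln_gt0 // ; move: H; nia.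
have : b.-1 < 5 * q * k by rewrite -mulnA -mE; lia.
move: q0 k0; clear; case: r => [|r]; first by lia.
move=> q0 k0 h1 h2.
have h3 : 4 * (2 * r.+1).+1 * b.-1 < 4 * (2 * r.+1).+1 * (5 * q * k) by rewrite ltn_pmul2l.
rewrite -(@ltn_pmul2l (q * r.+2)) ?muln_gt0 ?q0 //.
nia.
Qed.

(** * Counting multiples and their followers *)

Lemma count_dvd s J : 0 < s -> count (dvdn s) (iota 1 J) = J %/ s.
Proof.
move=> s0; elim: J => [|J IHJ]; first by rewrite div0n.
by rewrite -[in LHS](addn1 J) iotaD count_cat IHJ /= addn0 add1n divnS // addnC.
Qed.

Lemma count_has_dvd (S : seq nat) J : all (leq 1) S ->
  count (fun j => has (fun s => s %| j) S) (iota 1 J) <= \sum_(s <- S) J %/ s.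
Proof.
elim: S => [|s S IHS] /=; first by rewrite big_nil count_pred0.
case/andP=> s0 S0; rewrite big_cons -(count_dvd J s0).
apply: leq_trans (leq_add (leqnn _) (IHS S0)).
by rewrite -count_predUI leq_addr.
Qed.

(** [size_followers] allows [m - 2] elements; the last term, which has no follower yet, and the
    exception [e] add one each. Since [index] counts from 0, the follower has index two more. *)
Lemma card_followers N t m e : m \notin used t -> 1 < m ->
  #|[set i : 'I_N | (2 * i \in used t) &&
      [|| 2 * i == a t, 2 * i == e | a (index (2 * i) (used t)).+2 <= m]]| <= m.
Proof.
move=> mU m1; pose idx (i : 'I_N) := (index (2 * i) (used t)).+1.
pose G := [set i : 'I_N | [&& 2 * i \in used t, 2 * i != a t & a (idx i).+1 <= m]].
have card_eq c : #|[set i : 'I_N | 2 * i == c]| <= 1.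
  apply/card_le1_eqP => i j; rewrite !inE => /eqP ic /eqP jc; apply/val_inj => /=.
  by apply/eqP; rewrite -(eqn_pmul2l (isT : 0 < 2)) ic jc.
have cardG : #|G| <= m - 2.
  rewrite cardE -(size_map idx); apply: (size_followers (t := t)) => // [|k /mapP[i]].
    rewrite map_inj_in_uniq ?enum_uniq // => i j; rewrite !mem_enum !inE.
    case/and3P=> /index_used[ai _] _ _ /and3P[/index_used[aj _] _ _] ij.
    by apply/val_inj/eqP; rewrite /= -(eqn_pmul2l (isT : 0 < 2)) -ai -aj -/(idx i) ij.
  rewrite mem_enum inE => /and3P[/index_used[ai it] na am] ->; rewrite am andbT /=.
  by rewrite ltn_neqAle it andbT; apply: contraNneq na => <-; rewrite -ai.
apply: leq_trans (_ : #|G| + 1 + 1 <= m); last by lia.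
apply: leq_trans (leq_add (leq_add (leqnn _) (card_eq (a t))) (card_eq e)).
apply: leq_trans (leq_trans (leq_card_setU _ _) (leq_add (leq_card_setU _ _) (leqnn _))).
apply/subset_leq_card/subsetP => i; rewrite !inE -/(idx i) => /andP[-> /or3P[->|->|->]];
  by rewrite ?orbT ?andbT //=; case: eqP.
Qed.

(** The follower [z] is below [m], a missing multiple of [q], and odd since all even numbers up to
    [m] came by time [T]. The prime shared with [z] is [q], making [z] an odd multiple of [q] below
    [q * k], or it divides [j] and has a multiple at most [m] missing at time [T]. *)
Lemma late_cover t T q m k j (S : seq nat) J : prime q -> odd q -> m = q * k -> odd k ->
  m \notin used t -> T <= t -> m < least_unused T 2 -> 0 < j <= J ->
  2 * (q * j) \in used t -> 2 * (q * j) \notin used T -> 2 * (q * j) != a t ->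
  (forall s, prime s -> odd s -> s != q -> s <= J -> least_unused T s <= m -> s \in S) ->
  let z := a (index (2 * (q * j)) (used t)).+2 in
  (exists2 i, z = q * i.*2.+1 & i < k./2) \/ has (fun s => s %| j) S.
Proof.
move=> qp oq mE ok mU Tt mb /andP[j0 jJ] xU xnT xna HS.
have q0 := prime_gt0 qp.
have [ak kt] := index_used xU; set k' := index _ _ in ak kt *; move=> z.
have k't : k'.+1 < t by rewrite ltn_neqAle kt andbT; apply: contraNneq xna => <-; rewrite ak.
have Tk : T <= k'.
  by rewrite leqNgt; apply: contra xnT => kT; rewrite -ak; apply: mem_used.
have Tk' : T <= k'.+1 := leqW Tk.
have b2 := least_unused_even_ge2 T.
have k2 : 2 <= k'.+1.
  by rewrite ltnS; case: (k') ak => // a1; have [a1' _ _] := ha; move: a1; rewrite a1'; lia.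
have zm : z < m.
  rewrite ltn_neqAle; apply/andP; split.
    by apply: contraNneq mU => <-; apply: mem_used.
  apply: leq_trans (EKG_next_le k2 (prime_gt1 qp) _) _; first by rewrite ak mulnCA dvdn_mulr.
  have [_ _ _] := least_unusedP k'.+1 q0; apply; rewrite ?mE ?dvdn_mulr //.
    by rewrite muln_gt0 q0 odd_gt0.
  by rewrite -mE; apply: contra mU; apply: used_mono.
have zU : z \notin used k'.+1 by apply: EKG_fresh.
have z0 : 0 < z by apply: EKG_gt0.
have zT s : s %| z -> 0 < s -> least_unused T s <= z.
  by move=> sz s0; have [_ _ _] := least_unusedP T s0; apply => //; apply: contra zU; apply: used_mono.
have oz : odd z.
  rewrite -[odd z]negbK; apply/negP => ez.
  by have := zT 2; rewrite dvdn2 => /(_ ez isT); rewrite leqNgt (ltn_trans zm mb).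
have [s [sp sa sz]] := EKG_common_prime k2; rewrite -/z in sz; rewrite ak in sa.
have os : odd s := dvdn_odd sz oz.
have [sq|sq] := eqVneq s q; [left|right].
  move: sz; rewrite sq => /dvdnP[i zE]; exists i./2.
    rewrite zE mulnC; congr (_ * _); move: oz; rewrite zE oddM => /andP[oi _].
    by rewrite -[LHS]odd_double_half oi.
  have : i < k by rewrite -(ltn_pmul2r q0) -zE [k * q]mulnC -mE.
  by move: oz ok; rewrite zE oddM => /andP[oi _]; lia.
have sj : s %| j by move: sa; rewrite !Gauss_dvdr ?coprimen2 // prime_coprime // dvdn_prime2.
apply/hasP; exists s => //; apply: HS => //; first exact: leq_trans (dvdn_leq j0 sj) jJ.
by apply: leq_trans (zT s sz (prime_gt0 sp)) (ltnW zm).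
Qed.

(** This supplies the inclusions needed by [union_of_multiples]: as [2 * i < y], the number [2 * i]
    came by time [T], where the last hypothesis controls its follower. *)
Lemma multiples_followed N t m e y T s X : T <= t -> y <= least_unused T 2 -> 0 < s -> 2 * X < y ->
  (forall k, k < T -> 2 <= k.+1 < t -> a k.+1 != e -> s %| a k.+1 -> ~~ odd (a k.+1) ->
     a k.+2 <= m) ->
  multiples N s X \subset [set i : 'I_N | (2 * i \in used t) &&
      [|| 2 * i == a t, 2 * i == e | a (index (2 * i) (used t)).+2 <= m]].
Proof.
move=> Tt yT s0 Xy H; apply/subsetP => i; rewrite !inE => /and3P[i0 si iX].
have xU : 2 * i \in used T.
  apply: (lt_least_unused (s := 2)); rewrite ?muln_gt0 ?i0 ?dvdn_mulr //.
  by apply: leq_trans yT; apply: leq_ltn_trans Xy; rewrite leq_pmul2l.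
have xU' := used_mono Tt xU; rewrite xU' /=.
case: eqVneq => //= na; case: eqVneq => //= ne.
have [ak kt] := index_used xU'; have [ak' kT] := index_used xU.
have E : index (2 * i) (used t) = index (2 * i) (used T).
  by apply/succn_inj/EKG_inj => //; rewrite ak ak'.
have kt' : (index (2 * i) (used t)).+1 < t.
  by rewrite ltn_neqAle kt andbT; apply: contraNneq na => <-; rewrite ak.
have k2 : 2 <= (index (2 * i) (used t)).+1.
  rewrite ltnS; case: (index _ _) ak => // a1; have [a1' _ _] := ha.
  by move: a1; rewrite a1'; lia.
apply: H; rewrite ?ak ?oddM ?dvdn_mull //; first by rewrite E.
by rewrite k2 kt'.
Qed.

(** * Reciprocal sums and the case of an odd composite missing number *)

Lemma le_sum_divn (S : seq nat) J :
  ((\sum_(s <- S) J %/ s)%:R <= J%:R * \sum_(s <- S) s%:R^-1 :> rat)%R.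
Proof.
rewrite natr_sum mulr_sumr; apply: ler_sum => -[|s] _; first by rewrite divn0 invr0 mulr0.
by rewrite ler_pdivlMr ?ltr0n // -natrM ler_nat leq_trunc_div.
Qed.

Lemma size_le_sum_inv (S : seq nat) J : {in S, forall s, 0 < s <= J} ->
  ((size S)%:R <= J%:R * \sum_(s <- S) s%:R^-1 :> rat)%R.
Proof.
move=> HS; rewrite -sum1_size natr_sum mulr_sumr !big_seq; apply: ler_sum => s /HS/andP[s0 sJ].
by rewrite ler_pdivlMr ?ltr0n // mul1r ler_nat.
Qed.

(** The products [m x], [m x^2], [J x], [k x] and the quotients by [q] are named as separate
    variables, so that linear arithmetic suffices. *)
Lemma overfull_linear (m k J n sz u v x xx mx mxx Jx kx : rat) :
  (65 * k <= 3 * J + 2 -> 10 <= k -> n <= m -> sz <= Jx -> 0 <= m -> u <= k / 2 -> v <= 5 * kx / 2 ->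
   0 <= 13 / 12 * mx - mxx - m / 4 -> Jx <= 3 / 4 * J -> kx <= 3 / 4 * k ->
   m / 3 <= mx -> 0 <= xx ->
   m / 2 - 1 / 2 + J + 5 / 2 * mx - x / 2 - sz - u - mx / 2 + x / 2 - v - 5 / 4 * mxx + xx / 4 <= n ->
   False)%R.
Proof. lra. Qed.

(** The quadratic term in [x] is controlled by [(x - 1/3) * (3/4 - x) >= 0], which explains the
    range required of [x]. *)
Lemma overfull (m k J X b n sz q : nat) (x : rat) :
  m = q * k -> 0 < q -> 10 <= k -> 65 * k <= 3 * J + 2 -> 2 * b + 1 = m -> 2 * X + 1 = 5 * m ->
  (1 / 3 <= x <= 3 / 4)%R -> (sz%:R <= J%:R * x)%R -> n <= m ->
  (b%:R + J%:R + (X%:R * x - sz%:R) - b%:R / q%:R - b%:R * x - X%:R * x / q%:R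
    - X%:R * x ^+ 2 / 2 <= n%:R)%R -> False.
Proof.
move=> mE q0 k10 Jk bm Xm /andP[x1 x2] szJ nm.
have q0' : (0 < q%:R :> rat)%R by rewrite ltr0n.
have bm' : (b%:R = (m%:R - 1) / 2 :> rat)%R by rewrite -bm natrD natrM; field.
have Xm' : (X%:R = (5 * m%:R - 1) / 2 :> rat)%R.
  by rewrite -[(5 * m%:R)%R]natrM -Xm natrD natrM; field.
have x0 : (0 <= x)%R by apply: le_trans x1.
have x3 : (0 <= x - 1 / 3)%R by rewrite subr_ge0.
have x4 : (0 <= 3 / 4 - x)%R by rewrite subr_ge0.
have bq : (b%:R / q%:R <= k%:R / 2 :> rat)%R.
  rewrite ler_pdivrMr // bm' mE natrM -subr_ge0.
  by rewrite (_ : _ - _ = 1 / 2)%R //; field.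
have Xq : (X%:R * x / q%:R <= 5 * (k%:R * x) / 2 :> rat)%R.
  rewrite ler_pdivrMr // Xm' mE natrM -subr_ge0.
  by rewrite (_ : _ - _ = x / 2)%R; [rewrite divr_ge0 | field].
move=> H; apply: (@overfull_linear m%:R k%:R J%:R n%:R sz%:R (b%:R / q%:R)
  (X%:R * x / q%:R) x (x ^+ 2) (m%:R * x) (m%:R * x ^+ 2) (J%:R * x) (k%:R * x)).
- by rewrite -!natrM -natrD ler_nat.
- by rewrite ler_nat.
- by rewrite ler_nat.
- exact: szJ.
- exact: ler0n.
- exact: bq.
- exact: Xq.
- rewrite (_ : _ - _ - _ = m%:R * ((x - 1 / 3) * (3 / 4 - x)))%R; last by field.
  by rewrite mulr_ge0 ?ler0n // mulr_ge0.
- by rewrite [leRHS]mulrC; apply: ler_wpM2l => //; exact: x2.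
- by rewrite [leRHS]mulrC; apply: ler_wpM2l => //; exact: x2.
- by rewrite -[(3^-1)%R]div1r; apply: ler_wpM2l => //; exact: x1.
- exact: sqr_ge0.
apply: le_trans H; rewrite le_eqVlt; apply/orP; left; apply/eqP.
move: (b%:R / q%:R)%R (X%:R * x / q%:R)%R => u v.
by rewrite bm' Xm'; field.
Qed.

Lemma composite_bound t m : 1 <= t -> odd m -> 1 < m -> ~~ prime m -> m \notin used t ->
  3 * least_unused t 2 <= 130 * m.
Proof.
move=> t1 om m1 npm mU; set b := least_unused t 2; rewrite leqNgt; apply/negP => bm.
pose q := pdiv m; have qp : prime q by apply: pdiv_prime.
have [k mE] := dvdnP (pdiv_dvd m); rewrite -/q mulnC in mE.
have q0 := prime_gt0 qp.
have [oq ok] : odd q /\ odd k by apply/andP; rewrite -oddM -mE.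
have k1 : 1 < k.
  rewrite ltn_neqAle odd_gt0 // andbT; apply: contraNneq npm => k1.
  by rewrite mE -k1 muln1.
have qk : q <= k by apply: pdiv_min_dvd; rewrite // mE dvdn_mull.
have q3 : 2 < q by move: (prime_gt1 qp) oq; case: (q) => [|[|[|]]].
have m9 : 9 <= m by rewrite mE; nia.
(* [J] is 65 k / 3 rounded down: then [2 * q * J <= 130 * m / 3 < b], so all [2 * q * j] with
   [j <= J] have appeared. *)
have [J [J1 Jk]] : exists J, 3 * J <= 65 * k /\ 65 * k <= 3 * J + 2.
  by exists ((65 * k) %/ 3); clear; lia.
have [X Xm] : exists X, 2 * X + 1 = 5 * m.
  by exists (5 * m).-1./2; move: om m1; clear; lia.
have [c cm] : exists c, 2 * c + 1 = m.
  by exists m.-1./2; move: om m1; clear; lia.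
have Jb : 2 * (q * J) < b.
  have := leq_mul (leqnn (2 * q)) J1; move: bm; rewrite mE; move: (b); clear; lia.
have least_q k' : k' <= t -> least_unused k' q <= m.
  move=> k't; have [_ _ _] := least_unusedP k' q0; apply; rewrite ?mE ?dvdn_mulr //.
    by rewrite muln_gt0 q0 odd_gt0.
  by rewrite -mE; apply: contra mU; apply: used_mono.
have mb : m <= b by move: bm; move: (b); clear; lia.
(* By [T0.+1] all even numbers below [m] have appeared, and by [T.+1] all those below [5 * m]. *)
have [T0 [T0t aT0 T0m mT0]] := last_even (ltnW (ltnW (ltnW (ltnW (ltnW (ltnW m9)))))) mb.
have m5 : 2 < 5 * m by move: m9; clear; lia.
have [T [Tt aT Tm mT]] : exists T,
    [/\ T < t, a T.+1 = least_unused T 2, a T.+1 < 5 * m & 5 * m <= least_unused T.+1 2].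
  by apply: (last_even m5); move: bm; rewrite -/b; move: (b); clear; lia.
have [N [cN JN XN]] : exists N, [/\ c < N, q * J < N & X < N].
  exists (c + q * J + X).+1; rewrite !ltnS leq_addl -addnA leq_addr.
  by rewrite addnCA leq_addr.
pose G := [set i : 'I_N | (2 * i \in used t) &&
  [|| 2 * i == a t, 2 * i == a T0.+1 | a (index (2 * i) (used t)).+2 <= m]].
have cardG : #|G| <= m by apply: card_followers.
(* An even term of index at most [T0] has a follower at most [least_unused T0 2 = a T0.+1 < m]; the
   follower of [a T0.+1] itself is not controlled, whence the exception in [G]. *)
have G1 : multiples N 1 c \subset G.
  apply: (multiples_followed N T0t mT0) => //; first by move: cm; clear; lia.
  move=> k' k'T /andP[k2 k't] ne _ ek.
  have k'T0 : k' < T0.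
    by rewrite ltn_neqAle -ltnS k'T andbT; apply: contraNneq ne => ->.
  apply: leq_trans (EKG_next_le k2 (isT : 1 < 2) _) _; first by rewrite dvdn2.
  apply: leq_trans (least_unused_mono _ k'T0) _; first by [].
  by rewrite -aT0 ltnW.
have Gq : multiples N q (q * J) \subset G.
  apply: (multiples_followed N (leqnn t) (leqnn _)) => // k' _ /andP[k2 k't] _ qa _.
  by apply: leq_trans (EKG_next_le k2 (prime_gt1 qp) qa) _; apply/least_q/ltnW.
pose S := [seq s <- iota 0 J.+1 | [&& prime s, odd s, s != q & least_unused T.+1 s <= m]].
have GS s : s \in S -> multiples N s X \subset G.
  rewrite mem_filter => /andP[/and4P[sp os sq sm] _].
  apply: (multiples_followed N Tt mT); rewrite ?prime_gt0 //; first by move: Xm; clear; lia.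
  move=> k' k'T /andP[k2 _] _ sa _.
  apply: leq_trans (EKG_next_le k2 (prime_gt1 sp) sa) _.
  by apply: leq_trans sm; apply: least_unused_mono; rewrite ?prime_gt0.
have SP : [/\ all prime S, uniq S, q \notin S, all (leq 3) S & {in S, forall s, 0 < s <= J}].
  split.
  - by apply/allP => s; rewrite mem_filter => /andP[/and4P[]].
  - by rewrite filter_uniq ?iota_uniq.
  - by rewrite mem_filter eqxx /= !andbF.
  - apply/allP => s; rewrite mem_filter => /andP[/and4P[sp os _ _] _].
    by move: (prime_gt1 sp) os; case: (s) => [|[|[|]]].
  move=> s; rewrite mem_filter mem_iota => /andP[/and4P[/prime_gt0-> _ _ _]].
  by rewrite add0n ltnS.
have [Sp uS qS S3 SJ] := SP.
(* The sets for 1 and [q] alone give roughly [J <= m / 2 + k / 2]. If [k <= 9], then [q <= k] gives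
   [m <= 9 * k], against [J] near 65 k / 3. *)
have k10 : 10 <= k.
  have cap : #|multiples N 1 c :&: multiples N q (q * J)| <= c %/ q.
    rewrite -(card_multiples q0 cN); apply/subset_leq_card/subsetP => i; rewrite !inE.
    by case/andP=> /and3P[-> _ ->] /and3P[_ -> _].
  have := leq_trans (subset_leq_card (introT subUsetP (conj G1 Gq))) cardG.
  rewrite cardsU !card_multiples // divn1 mulKn //.
  have hq : 2 * (c %/ q) < k.
    rewrite -(ltn_pmul2l q0) -mE -cm; have := leq_trunc_div c q; clear; lia.
  move=> H; rewrite leqNgt; apply/negP => k9.
  have : m <= 9 * k by rewrite mE leq_pmul2r ?(ltnW k1) //; apply: leq_trans qk _; rewrite -ltnS.
  by move: H cap hq Jk cm; move: #|_ :&: _| (c %/ q) => u v; clear; lia.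
have T1 : 1 <= T by case: (T) aT => //; have [-> _ _] := ha.
(* At least [X] even numbers, about [5 * m / 2], are used by [T.+1], and [count_evens] makes this
   number at most [least_unused T 2]. *)
have mbT : m < least_unused T 2.
  have E := count_evens T1.
  have : X <= #|[set i : 'I_N | 2 * i \in used T.+1]|.
    rewrite -[leqLHS]divn1 -(card_multiples (isT : 0 < 1) XN); apply/subset_leq_card/subsetP => i.
    rewrite !in_set => /and3P[i0 _ iX].
    apply: (lt_least_unused (s := 2)); rewrite ?muln_gt0 ?i0 ?dvdn_mulr //.
    by apply: leq_trans mT; move: iX Xm; clear; lia.
  move=> H; have := leq_trans H (card_halves_used N T.+1).
  rewrite usedS -cats1 count_cat /= addn0; move: E m9 Xm.
  move: (count _ _) (least_unused T 2) => n d; clear; case: (odd (a T)); case: (odd _) => /=; lia.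
have mUT : m \notin used T by apply: contra mU; apply: used_mono; apply: ltnW.
have k0 : 0 < k := ltnW k1.
have b5 : least_unused T 2 < 5 * m by rewrite -aT.
have early := early_multiples_lt J qp oq mE k0 T1 mUT mbT b5.
have mT' : m < least_unused T.+1 2 by apply: leq_trans mT; move: m1; clear; lia.
pose z j := a (index (2 * (q * j)) (used t)).+2.
pose Q := [seq q * i.*2.+1 | i <- iota 0 k./2].
pose P1 j := 2 * q * j \in used T.
pose P3 c j := 2 * (q * j) == c.
pose P4 j := (0 < j <= J) && (z j \in Q).
pose P5 j := has (fun s => s %| j) S.
have xU j : 0 < j <= J -> 2 * (q * j) \in used t.
  move=> /andP[j0 jJ]; apply: (lt_least_unused (s := 2)); rewrite ?muln_gt0 ?q0 ?dvdn_mulr //.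
  by apply: leq_ltn_trans Jb; rewrite !leq_mul2l jJ !orbT.
(* Each [2 * q * j] came by time [T], is one of the terms [a T.+1] and [a t], is followed by an odd
   multiple of [q], or has [j] divisible by some [s] in [S]. *)
have cover j : j \in iota 1 J -> P1 j || (P3 (a T.+1) j || (P3 (a t) j || (P4 j || P5 j))).
  rewrite mem_iota add1n ltnS => j0J; rewrite /P4 j0J /=.
  case: (boolP (P1 j)) => //= n1; case: (boolP (P3 _ j)) => //= n2; case: (boolP (P3 _ j)) => //= n3.
  have xnT : 2 * (q * j) \notin used T.+1.
    by rewrite usedS mem_rcons inE negb_or n2 mulnA.
  have HS s : prime s -> odd s -> s != q -> s <= J -> least_unused T.+1 s <= m -> s \in S.
    by move=> sp os sq sJ sm; rewrite mem_filter sp os sq sm mem_iota.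
  have [[i zE ik]|H] := late_cover qp oq mE ok mU Tt mT' j0J (xU j j0J) xnT n3 HS; last by rewrite /P5 H orbT.
  by apply/orP; left; apply/mapP; exists i; rewrite ?mem_iota.
have count_or (A B : pred nat) l : count (fun j => A j || B j) l <= count A l + count B l.
  by rewrite -count_predUI leq_addr.
have countP3 d : count (P3 d) (iota 1 J) <= 1.
  have -> : count (P3 d) (iota 1 J) = count_mem d [seq 2 * (q * j) | j <- iota 1 J].
    by rewrite count_map; apply: eq_count => j.
  rewrite count_uniq_mem ?leq_b1 // map_inj_uniq ?iota_uniq // => i j /eqP.
  by rewrite !eqn_pmul2l // => /eqP.
have countP4 : count P4 (iota 1 J) <= k./2.
  rewrite -size_filter -[leqRHS](size_iota 0) -(size_map (fun i => q * i.*2.+1) (iota _ _)) -/Q.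
  rewrite -(size_map z); apply: uniq_leq_size => [|y /mapP[j]]; last first.
    by rewrite mem_filter => /andP[/andP[_ ?] _] ->.
  rewrite map_inj_in_uniq ?filter_uniq ?iota_uniq // => i j; rewrite !mem_filter.
  case/andP=> /andP[/xU/index_used[ai _] _] _ /andP[/andP[/xU/index_used[aj _] _] _] /EKG_inj.
  move=> /(_ isT isT) [ij]; move: ai; rewrite ij aj => /eqP.
  by rewrite !eqn_pmul2l // => /eqP.
have J_le : J <= count P1 (iota 1 J) + (1 + (1 + (k./2 + \sum_(s <- S) J %/ s))).
  have E := size_iota 1 J; rewrite -{1}E.
  have -> : size (iota 1 J) =
      count (fun j => P1 j || (P3 (a T.+1) j || (P3 (a t) j || (P4 j || P5 j)))) (iota 1 J).
    by apply/eqP; rewrite eq_sym -all_count; apply/allP.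
  do 4![apply: leq_trans (count_or _ _ _) _; apply: leq_add; rewrite ?countP3 //].
  apply: count_has_dvd; apply/allP => s sS; by have /andP[] := SJ s sS.
(* Early multiples take less than 40 k / 3 of the 65 k / 3, and the other cases k / 2 + 2; for
   [k >= 10] more than a third of [J] is left. *)
have sumS : J <= 3 * \sum_(s <- S) J %/ s.
  move: J_le early Jk k10; rewrite -/P1; move: (count _ _) (\sum_(s <- S) _) => u v.
  by clear; lia.
have J0 : 0 < J by move: Jk k10; clear; lia.
have J0' : (0 < J%:R :> rat)%R by rewrite ltr0n.
have sigma : (1 / 3 <= \sum_(s <- S) s%:R^-1 :> rat)%R.
  have h1 : (J%:R <= 3 * (\sum_(s <- S) J %/ s)%:R :> rat)%R by rewrite -natrM ler_nat.
  rewrite -(ler_pM2l J0') mulrA mulr1 ler_pdivrMr ?ltr0n // mulrC.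
  by apply: le_trans h1 _; rewrite ler_pM2l ?ltr0n //; apply: le_sum_divn.
have m13 : (- (1 / 3) <= 1 / 3 :> rat)%R by apply: le_trans (_ : 0 <= _)%R; rewrite ?oppr_le0 divr_ge0.
(* Some prefix of [S] has reciprocal sum between 1/3 and 2/3, inside the range of [overfull]. *)
have [n s1 s2] := take_sum_inv S3 m13 sigma.
set x := (\sum_(s <- take n S) s%:R^-1)%R in s1 s2.
have tS s : s \in take n S -> s \in S by apply: mem_take.
have Sp' : all prime (take n S) by apply/allP => s /tS/(allP Sp).
have qS' : q \notin take n S by apply: contra qS; apply: tS.
have GS' s : s \in take n S -> multiples N s X \subset G by move=> /tS; apply: GS.
have H := union_of_multiples qp Sp' (take_uniq n uS) qS' cN JN XN G1 Gq GS' (erefl x).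
have szx : ((size (take n S))%:R <= J%:R * x :> rat)%R.
  by apply: size_le_sum_inv => s /tS; apply: SJ.
apply: (overfull mE q0 k10 Jk cm Xm _ szx cardG H).
by rewrite s1; apply: le_trans s2 _.
Qed.

(** * Missing primes and the final bound *)

(** The first multiple of [q] would be [s * q], with [s] the prime shared with its predecessor. Its
    follower is at most [q], and below [q] as [q] is missing, so it shares [s]; but then it is at
    least [s * q]. The last index [t] is excluded because its follower may be [q]. *)
Lemma unused_prime_ndvd t q k : prime q -> odd q -> q \notin used t -> 1 <= k < t -> ~~ (q %| a k).
Proof.
move=> qp oq qU; have q0 := prime_gt0 qp; have q1 := prime_gt1 qp.
have [a1 a2 _] := ha.
elim/ltn_ind: k => -[|[|[|k]]] // IH; first by rewrite a1 dvdn1 gtn_eqF.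
  by rewrite a2 dvdn_prime2 //; case: eqP oq => // ->.
move=> /andP[_ kt]; apply/negP => qk.
have IHu i : i <= k.+2 -> 1 <= i -> ~~ (q %| a i).
  by move=> ik i1; apply: IH; rewrite ?i1 //; apply: leq_ltn_trans ik (ltnW kt).
have nU k' r : k' <= t -> r = q -> r \notin used k' by move=> k't ->; apply: contra qU; apply: used_mono.
have k2 : 2 <= k.+2 by [].
have [s [sp sa sa']] := EKG_common_prime k2.
have sE := EKG_next_eq k2 (prime_gt1 sp) sa sa'.
have sq : s != q by apply: contraTneq sa => ->; apply: IHu.
have s0 := prime_gt0 sp.
have sqU : s * q \notin used k.+2.
  apply/usedP => -[i /andP[i1 ik] ai]; have := IHu i ik i1; by rewrite ai dvdn_mull.
have ale : a k.+3 <= s * q.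
  rewrite sE; have [_ _ _] := least_unusedP k.+2 s0; apply => //; first by rewrite muln_gt0 s0.
  by rewrite dvdn_mulr.
have aE : a k.+3 = s * q.
  apply/eqP; rewrite eqn_leq ale dvdn_leq ?EKG_gt0 // Gauss_dvd ?sa' //.
  by rewrite prime_coprime // dvdn_prime2.
have k3 : 2 <= k.+3 by [].
have aq : a k.+4 <= q.
  apply: leq_trans (EKG_next_le k3 q1 qk) _; have [_ _ _] := least_unusedP k.+3 q0; apply => //.
  exact: nU (ltnW kt) _.
have aq' : a k.+4 < q.
  by rewrite ltn_neqAle aq andbT; apply: contraNneq qU => <-; apply: mem_used; rewrite /= kt.
have [r [rp ra ra']] := EKG_common_prime k3.
have rE := EKG_next_eq k3 (prime_gt1 rp) ra ra'.
move: ra; rewrite aE Euclid_dvdM // !dvdn_prime2 // => /orP[/eqP rs|/eqP rq].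
  have : s * q <= a k.+4 by rewrite rE rs -aE sE; apply: least_unused_mono.
  by rewrite leqNgt (leq_trans aq') // leq_pmull.
by move: ra'; rewrite rq => /(dvdn_leq (EKG_gt0 (isT : 1 <= k.+4))); rewrite leqNgt aq'.
Qed.

Lemma EKG_index_bound t m : 1 <= t -> 0 < m -> m \notin used t -> t < 260 * m.
Proof.
move=> t1 m0 mU; have T := index_lt_least t1; have [a1 _ _] := ha.
have m1 : 1 < m.
  by rewrite ltn_neqAle m0 andbT; apply: contraNneq mU => <-; rewrite -a1 mem_used // t1.
have [om|em] := boolP (odd m); last first.
  have : least_unused t 2 <= m by have [_ _ _] := least_unusedP t (isT : 0 < 2); apply; rewrite ?dvdn2.
  by move: T m0; clear; lia.
have [mp|mp] := boolP (prime m); last first.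
  by have := composite_bound t1 om m1 mp mU; move: T; clear; lia.
(* For [m] prime, [2 * m] may be the last term, so the least missing even number is bounded one step
   earlier. *)
case: t t1 mU T => [|[|t]] // _ mU _; first by move: m1; clear; lia.
have T := index_lt_least (isT : 1 <= t.+1).
have : least_unused t.+1 2 <= 2 * m.
  have [_ _ _] := least_unusedP t.+1 (isT : 0 < 2); apply; rewrite ?muln_gt0 ?dvdn_mulr //.
  apply/usedP => -[k kt ak]; have := unused_prime_ndvd mp om mU kt.
  by rewrite ak dvdn_mull.
by move: T m0; clear; lia.
Qed.

End EKG.

Theorem theorem3 (a : nat -> nat) (ha : is_EKG a) (n : nat) (hn : (1 <= n)%N) :
  (Num.ceil (n%:Q / 260%:Q) <= (a n)%:Z)%R.
Proof.
have n_le : n <= 260 * a n.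
  (* [a n] is missing from the first [n - 1] terms, so the index bound applies with [t = n - 1]. *)
  case: n hn => [|[|t]] // _; first by have [-> _ _] := ha.
  by apply: (EKG_index_bound ha); [|apply: (EKG_gt0 ha)|apply: (EKG_fresh ha)].
rewrite ceil_le_int ler_pdivrMr // -[leRHS]intrM ler_int.
by rewrite -PoszM mulnC lez_nat.
Qed.
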